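(* Let $K$ be an algebraically closed field of characteristic zero, let $\lambda\in K$, and let $P_\lambda=P(\mathrm{sl}_2(K))/(C_P-\lambda)$. The group $G=\mathrm{Aut}(P_\lambda)$ of Poisson algebra automorphisms of $P_\lambda$ is the free product of its subgroups $A$ (linear automorphisms) and $T$ (triangular automorphisms) with amalgamated subgroup $C=A\cap T$, i.e. $$G=A\ast_{C}T.$$
   Context: $\mathrm{sl}_2(K)$ has basis $E,H,F$ with $[E,F]=H$, $[H,E]=2E$, $[H,F]=-2F$. The Poisson enveloping algebra $P(\mathrm{sl}_2(K))$ is the polynomial algebra $K[E,H,F]$ with the unique Poisson bracket extending the Lie bracket via the Leibniz identity. The Casimir element is $C_P=4EF+H^2$. The images of $E,H,F$ in $P_\lambda$ are denoted $e,h,f$; they satisfy $\{e,f\}=h$, $\{h,e\}=2e$, $\{h,f\}=-2f$, $4ef+h^2=\lambda$. Automorphisms of $P_\lambda$ preserve both the commutative product and the Poisson bracket; the group operation is composition of maps. $A$ is the group $\mathrm{Aut}(\mathrm{sl}_2(K))$ of Lie algebra automorphisms, identified with a subgroup of $G$ (each automorphism of $\mathrm{sl}_2(K)$, viewed as a linear automorphism of the span of $e,h,f$, extends uniquely to an automorphism of $P_\lambda$). $T$ is the subgroup of $G$ generated by all $\Delta_g$, $g(x)\in K[x]$, where $\Delta_g(e)=e-g(f)h-fg(f)^2$, $\Delta_g(h)=h+2fg(f)$, $\Delta_g(f)=f$, and all hyperbolic rotations $H_\nu$, $\nu\in K^*$, where $H_\nu(e)=\nu e$, $H_\nu(h)=h$,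 $H_\nu(f)=\nu^{-1}f$. A group $G$ with subgroups $G_1,G_2$ and $G_0=G_1\cap G_2$ is the free product of $G_1$ and $G_2$ with amalgamated subgroup $G_0$, written $G=G_1\ast_{G_0}G_2$, if $G$ is generated by $G_1$ and $G_2$ and its defining relations consist only of those of $G_1$ and of $G_2$ (i.e. the canonical homomorphism from the abstract amalgamated product to $G$ is an isomorphism). *)

(* Defs.v *)
From HB Require Import structures.
From mathcomp Require Import all_boot all_order all_algebra ring_quotient.
From mathcomp Require Import ring.
From mathcomp Require Import boolp classical_sets.
From mathcomp Require Import mpoly.

Set Implicit Arguments.
Unset Strict Implicit.
Unset Printing Implicit Defensive.

Import GRing.Theory.

Local Open Scope ring_scope.
Local Open Scope quotient_scope.

Section PoissonAutomorphisms.
Variables (K : fieldType) (P : comAlgType K) (br : P -> P -> P).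

Definition is_poisson_bracket : Prop :=
  [/\ forall a x y z, br (a *: x + y) z = a *: br x z + br y z,
      forall x, br x x = 0,
      forall x y, br x y = - br y x,
      forall x y z, br x (br y z) + br y (br z x) + br z (br x y) = 0 &
      forall x y z, br x (y * z) = br x y * z + y * br x z].

Definition is_poisson_aut (f : P -> P) : Prop :=
  [/\ linear f, f 1 = 1, {morph f : x y / x * y}, {morph f : x y / br x y}
    & bijective f].

(* The boolean form of the property makes poisson_aut a subtype of P -> P. *)
Record poisson_aut := PoissonAut {
  paut_fun :> P -> P;
  _ : `[< is_poisson_aut paut_fun >] }.

HB.instance Definition _ := [isSub for paut_fun].
HB.instance Definition _ := [Choice of poisson_aut by <:].

Lemma pautP (s : poisson_aut) : is_poisson_aut s.
Proof. exact/asboolP/(valP s). Qed.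

Definition mk_paut f (fP : is_poisson_aut f) : poisson_aut :=
  PoissonAut (asboolT fP).

Lemma paut_ext (s t : poisson_aut) : s =1 t -> s = t.
Proof. by move=> st; apply: val_inj; apply: funext. Qed.

Lemma is_paut_id : is_poisson_aut id.
Proof. by split=> //; exists id. Qed.

Lemma is_paut_comp f g :
  is_poisson_aut f -> is_poisson_aut g -> is_poisson_aut (f \o g).
Proof.
move=> [lf f1 fM fB bf] [lg g1 gM gB bg]; split=> [a x y||x y|x y|] /=.
- by rewrite lg lf.
- by rewrite g1 f1.
- by rewrite gM fM.
- by rewrite gB fB.
- exact: bij_comp.
Qed.

Lemma is_paut_can f g :
  is_poisson_aut f -> cancel f g -> cancel g f -> is_poisson_aut g.
Proof.
move=> [lf f1 fM fB _] fK gK; have fi := can_inj fK.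
split=> [a x y||x y|x y|]; last by exists f.
- by apply: fi; rewrite lf !gK.
- by apply: fi; rewrite gK.
- by apply: fi; rewrite fM !gK.
- by apply: fi; rewrite fB !gK.
Qed.

Lemma paut_inv_ex (s : poisson_aut) :
  exists t : poisson_aut, cancel s t /\ cancel t s.
Proof.
have [_ _ _ _ [g sK gK]] := pautP s.
by exists (mk_paut (is_paut_can (pautP s) sK gK)).
Qed.

Definition paut_one := mk_paut is_paut_id.
Definition paut_mul (s t : poisson_aut) :=
  mk_paut (is_paut_comp (pautP s) (pautP t)).
Definition paut_inv s := projT1 (cid (paut_inv_ex s)).

Lemma paut_mulA : associative paut_mul.
Proof. by move=> s t u; apply: paut_ext. Qed.
Lemma paut_mul1 : left_id paut_one paut_mul.
Proof. by move=> s; apply: paut_ext. Qed.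
Lemma paut_mulr1 : right_id paut_one paut_mul.
Proof. by move=> s; apply: paut_ext. Qed.
Lemma paut_mulV : left_inverse paut_one paut_inv paut_mul.
Proof.
move=> s; apply: paut_ext => x /=; rewrite /paut_inv.
by case: cid => t [].
Qed.
Lemma paut_mulrV : right_inverse paut_one paut_inv paut_mul.
Proof.
move=> s; apply: paut_ext => x /=; rewrite /paut_inv.
by case: cid => t [].
Qed.

HB.instance Definition _ := isGroup.Build poisson_aut
  paut_mulA paut_mul1 paut_mulr1 paut_mulV paut_mulrV.

Lemma paut_mulE (s t : poisson_aut) x : (s * t)%g x = s (t x).
Proof. by []. Qed.

End PoissonAutomorphisms.

Section AmalgamatedProduct.
Variable G : groupType.
Local Open Scope group_scope.

Definition is_subgroup (H : set G) : Prop :=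
  [/\ H 1, forall x y, H x -> H y -> H (x * y) & forall x, H x -> H x^-1].

Inductive generated (S : set G) : set G :=
| generated_in x : S x -> generated S x
| generated_1 : generated S 1
| generated_M x y : generated S x -> generated S y -> generated S (x * y)
| generated_V x : generated S x -> generated S x^-1.

Variables G1 G2 G0 : set G.

(* A letter (b, x) is the copy of x in the first (b = false) or the second
   (b = true) factor of the abstract product. *)
Definition factor (b : bool) : set G := if b then G2 else G1.

Definition amalgam_word (w : seq (bool * G)) : Prop :=
  forall l, l \in w -> factor l.1 l.2.

Definition word_val (w : seq (bool * G)) : G := \prod_(l <- w) l.2.

(* The abstract product of G1 and G2 amalgamated along G0 is the set of
   amalgam_words modulo this congruence, multiplication being concatenation:
   the relations are the multiplication tables of G1 and of G2, plus the
   identification of the two copies of G0. No formal inverses of letters are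
   needed, the inverse of (b, x) being (b, x^-1). *)
Inductive amalgam_eq : seq (bool * G) -> seq (bool * G) -> Prop :=
| amalgam_refl w : amalgam_eq w w
| amalgam_sym w w' : amalgam_eq w w' -> amalgam_eq w' w
| amalgam_trans w w' w'' :
    amalgam_eq w w' -> amalgam_eq w' w'' -> amalgam_eq w w''
| amalgam_one b u v : amalgam_eq (u ++ (b, 1) :: v) (u ++ v)
| amalgam_mul b x y u v : factor b x -> factor b y ->
    amalgam_eq (u ++ (b, x) :: (b, y) :: v) (u ++ (b, x * y) :: v)
| amalgam_glue c u v : G0 c ->
    amalgam_eq (u ++ (false, c) :: v) (u ++ (true, c) :: v).

(* word_val induces the canonical homomorphism from the abstract amalgamated
   product to G; the last two clauses are its surjectivity and injectivity. *)
Definition is_amalgamated_product : Prop :=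
  [/\ is_subgroup G1, is_subgroup G2, G0 = (G1 `&` G2)%classic,
      forall g, exists2 w, amalgam_word w & word_val w = g &
      forall w w', amalgam_word w -> amalgam_word w' ->
        word_val w = word_val w' -> amalgam_eq w w'].

End AmalgamatedProduct.

(* E, H, F are the variables number 0, 1, 2 and the coordinates 0, 1, 2 of
   vectors of sl_2(K). *)
Definition iE : 'I_3 := @Ordinal 3 0 isT.
Definition iH : 'I_3 := @Ordinal 3 1 isT.
Definition iF : 'I_3 := @Ordinal 3 2 isT.

Lemma big_I3 (V : nmodType) (f : 'I_3 -> V) :
  \sum_i f i = f iE + f iH + f iF.
Proof.
rewrite !big_ord_recl big_ord0 addr0 addrA.
by congr (f _ + f _ + f _); apply: val_inj.
Qed.

Section Sl2.
Variable K : fieldType.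
Implicit Types u v w : 'rV[K]_3.

Definition sl2_E : 'rV[K]_3 := delta_mx 0 iE.
Definition sl2_H : 'rV[K]_3 := delta_mx 0 iH.
Definition sl2_F : 'rV[K]_3 := delta_mx 0 iF.

Definition sl2_bracket u v : 'rV[K]_3 :=
    (2 * (u 0 iH * v 0 iE - u 0 iE * v 0 iH)) *: sl2_E
  + (u 0 iE * v 0 iF - u 0 iF * v 0 iE) *: sl2_H
  + (2 * (u 0 iF * v 0 iH - u 0 iH * v 0 iF)) *: sl2_F.

Let simp := (mulr0, mul0r, mulr1, subr0, sub0r, oppr0, mulrN1, scale0r,
  scale1r, addr0, add0r, subrr, mulrN).

Lemma sl2_EF : sl2_bracket sl2_E sl2_F = sl2_H.
Proof. by rewrite /sl2_bracket !mxE /= !simp. Qed.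
Lemma sl2_HE : sl2_bracket sl2_H sl2_E = 2 *: sl2_E.
Proof. by rewrite /sl2_bracket !mxE /= !simp. Qed.
Lemma sl2_HF : sl2_bracket sl2_H sl2_F = (- 2) *: sl2_F.
Proof. by rewrite /sl2_bracket !mxE /= !simp. Qed.

Definition sl2_lie_aut (phi : {linear 'rV[K]_3 -> 'rV[K]_3}) : Prop :=
  bijective phi /\ {morph phi : u v / sl2_bracket u v}.

Definition lincomb (V : lmodType K) (x : 'I_3 -> V) u : V :=
  \sum_i u 0 i *: x i.

Notation Psl2 := {mpoly K[3]}.
Implicit Types p q r : Psl2.

(* The biderivation taking the value [x_i, x_j] on the variables; it is a
   Poisson bracket (P_bracket_poisson) extending the Lie bracket
   (P_bracket_lin). *)
Definition P_bracket p q : Psl2 :=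
  \sum_i \sum_j p^`M(i) * q^`M(j) *
    lincomb (fun k => 'X_k) (sl2_bracket (delta_mx 0 i) (delta_mx 0 j)).

Lemma lincomb_bracket (V : lmodType K) (x : 'I_3 -> V) u v :
  lincomb x (sl2_bracket u v) =
    (2 * (u 0 iH * v 0 iE - u 0 iE * v 0 iH)) *: x iE
  + (u 0 iE * v 0 iF - u 0 iF * v 0 iE) *: x iH
  + (2 * (u 0 iF * v 0 iH - u 0 iH * v 0 iF)) *: x iF.
Proof. by rewrite /lincomb big_I3 !mxE /= !simp. Qed.

Lemma P_bracketE p q : P_bracket p q =
    (p^`M(iE) * q^`M(iF) - p^`M(iF) * q^`M(iE)) * 'X_iH
  + 2 * (p^`M(iH) * q^`M(iE) - p^`M(iE) * q^`M(iH)) * 'X_iE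
  + 2 * (p^`M(iF) * q^`M(iH) - p^`M(iH) * q^`M(iF)) * 'X_iF.
Proof.
rewrite /P_bracket !big_I3 !lincomb_bracket !mxE /=.
rewrite !simp !scaleNr scale1r !scaler_nat; ring.
Qed.

Lemma mderivXU i j : ('X_i : Psl2)^`M(j) = (i == j)%:R.
Proof.
rewrite mderivX mnm1E; case: eqP => [->|_]; last by rewrite scale0r.
by rewrite scale1r -[X in (X - _)%MM]add0m addmK mpolyX0.
Qed.

Lemma jacobi_aux (S : comNzRingType) (e h f pe ph pf qe qh qf re rh rf
    pee peh pef phh phf pff qee qeh qef qhh qhf qff
    ree reh ref rhh rhf rff : S) :
  let B pe ph pf qe qh qf := (pe * qf - pf * qe) * h
    + 2 * (ph * qe - pe * qh) * e + 2 * (pf * qh - ph * qf) * f in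
  let J pe ph pf qe qh qf re rh rf qee qeh qef qhh qhf qff
        ree reh ref rhh rhf rff :=
    B pe ph pf
     ((qee * rf + qe * ref - (qef * re + qf * ree)) * h
      + 2 * (qeh * re + qh * ree - (qee * rh + qe * reh)) * e
      + 2 * (qh * re - qe * rh)
      + 2 * (qef * rh + qf * reh - (qeh * rf + qh * ref)) * f)
     ((qeh * rf + qe * rhf - (qhf * re + qf * reh)) * h + (qe * rf - qf * re)
      + 2 * (qhh * re + qh * reh - (qeh * rh + qe * rhh)) * e
      + 2 * (qhf * rh + qf * rhh - (qhh * rf + qh * rhf)) * f)
     ((qef * rf + qe * rff - (qff * re + qf * ref)) * h
      + 2 * (qhf * re + qh * ref - (qef * rh + qe * rhf)) * e
      + 2 * (qff * rh + qf * rhf - (qhf * rf + qh * rff)) * f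
      + 2 * (qf * rh - qh * rf)) in
  J pe ph pf qe qh qf re rh rf qee qeh qef qhh qhf qff ree reh ref rhh rhf rff
  + J qe qh qf re rh rf pe ph pf ree reh ref rhh rhf rff pee peh pef phh phf pff
  + J re rh rf pe ph pf qe qh qf pee peh pef phh phf pff qee qeh qef qhh qhf qff
  = 0.
Proof. by move=> /=; ring. Qed.

Lemma P_bracket_dE p q : (P_bracket p q)^`M(iE) =
  (p^`M(iE)^`M(iE) * q^`M(iF) + p^`M(iE) * q^`M(iE)^`M(iF)
     - (p^`M(iE)^`M(iF) * q^`M(iE) + p^`M(iF) * q^`M(iE)^`M(iE))) * 'X_iH
  + 2 * (p^`M(iE)^`M(iH) * q^`M(iE) + p^`M(iH) * q^`M(iE)^`M(iE)
     - (p^`M(iE)^`M(iE) * q^`M(iH) + p^`M(iE) * q^`M(iE)^`M(iH))) * 'X_iE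
  + 2 * (p^`M(iH) * q^`M(iE) - p^`M(iE) * q^`M(iH))
  + 2 * (p^`M(iE)^`M(iF) * q^`M(iH) + p^`M(iF) * q^`M(iE)^`M(iH)
     - (p^`M(iE)^`M(iH) * q^`M(iF) + p^`M(iH) * q^`M(iE)^`M(iF))) * 'X_iF.
Proof.
rewrite P_bracketE -!mulrA !mulr_natl !(mderivD, mderivMn, mderivN, mderivM).
rewrite !mderivXU /=.
rewrite ?(mderiv_comm iH iE, mderiv_comm iF iE, mderiv_comm iF iH).
ring.
Qed.

Lemma P_bracket_dH p q : (P_bracket p q)^`M(iH) =
  (p^`M(iE)^`M(iH) * q^`M(iF) + p^`M(iE) * q^`M(iH)^`M(iF)
     - (p^`M(iH)^`M(iF) * q^`M(iE) + p^`M(iF) * q^`M(iE)^`M(iH))) * 'X_iH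
  + (p^`M(iE) * q^`M(iF) - p^`M(iF) * q^`M(iE))
  + 2 * (p^`M(iH)^`M(iH) * q^`M(iE) + p^`M(iH) * q^`M(iE)^`M(iH)
     - (p^`M(iE)^`M(iH) * q^`M(iH) + p^`M(iE) * q^`M(iH)^`M(iH))) * 'X_iE
  + 2 * (p^`M(iH)^`M(iF) * q^`M(iH) + p^`M(iF) * q^`M(iH)^`M(iH)
     - (p^`M(iH)^`M(iH) * q^`M(iF) + p^`M(iH) * q^`M(iH)^`M(iF))) * 'X_iF.
Proof.
rewrite P_bracketE -!mulrA !mulr_natl !(mderivD, mderivMn, mderivN, mderivM).
rewrite !mderivXU /=.
rewrite ?(mderiv_comm iH iE, mderiv_comm iF iE, mderiv_comm iF iH).
ring.
Qed.

Lemma P_bracket_dF p q : (P_bracket p q)^`M(iF) =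
  (p^`M(iE)^`M(iF) * q^`M(iF) + p^`M(iE) * q^`M(iF)^`M(iF)
     - (p^`M(iF)^`M(iF) * q^`M(iE) + p^`M(iF) * q^`M(iE)^`M(iF))) * 'X_iH
  + 2 * (p^`M(iH)^`M(iF) * q^`M(iE) + p^`M(iH) * q^`M(iE)^`M(iF)
     - (p^`M(iE)^`M(iF) * q^`M(iH) + p^`M(iE) * q^`M(iH)^`M(iF))) * 'X_iE
  + 2 * (p^`M(iF)^`M(iF) * q^`M(iH) + p^`M(iF) * q^`M(iH)^`M(iF)
     - (p^`M(iH)^`M(iF) * q^`M(iF) + p^`M(iH) * q^`M(iF)^`M(iF))) * 'X_iF
  + 2 * (p^`M(iF) * q^`M(iH) - p^`M(iH) * q^`M(iF)).
Proof.
rewrite P_bracketE -!mulrA !mulr_natl !(mderivD, mderivMn, mderivN, mderivM).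
rewrite !mderivXU /=.
rewrite ?(mderiv_comm iH iE, mderiv_comm iF iE, mderiv_comm iF iH).
ring.
Qed.

Lemma P_bracket_poisson : is_poisson_bracket P_bracket.
Proof.
split=> [a p q r|p|p q|p q r|p q r].
- rewrite !P_bracketE !mderivD !mderivZ -!mul_mpolyC; ring.
- rewrite P_bracketE; ring.
- rewrite !P_bracketE; ring.
- rewrite ![P_bracket _ (P_bracket _ _)]P_bracketE.
  rewrite !(P_bracket_dE, P_bracket_dH, P_bracket_dF).
  exact: (jacobi_aux 'X_iE 'X_iH 'X_iF p^`M(iE) p^`M(iH) p^`M(iF)
    q^`M(iE) q^`M(iH) q^`M(iF) r^`M(iE) r^`M(iH) r^`M(iF)).
- rewrite !P_bracketE !mderivM; ring.
Qed.

Lemma P_bracket_lin u v :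
  P_bracket (lincomb (fun i => 'X_i) u) (lincomb (fun i => 'X_i) v) =
  lincomb (fun i => 'X_i) (sl2_bracket u v).
Proof.
have dl w k : (lincomb (fun i => 'X_i : Psl2) w)^`M(k) = (w 0 k)%:MP.
  rewrite /lincomb linear_sum (bigD1 k) //= big1 => [|i ik].
    by rewrite mderivZ mderivXU eqxx addr0 -mul_mpolyC mulr1.
  by rewrite mderivZ mderivXU (negPf ik) scaler0.
rewrite P_bracketE !dl lincomb_bracket -!mul_mpolyC.
rewrite !(rmorphM, rmorphB) /= !(rmorphM, rmorphB, rmorph_nat) /=; ring.
Qed.

Definition casimir : Psl2 := 4 * 'X_iE * 'X_iF + 'X_iH ^+ 2.

Lemma P_bracket_casimir p : P_bracket casimir p = 0.
Proof.
rewrite P_bracketE /casimir expr2 -mulrA mulr_natl.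
rewrite !(mderivD, mderivMn, mderivM) !mderivXU /=; ring.
Qed.

End Sl2.

Section CasimirIdeal.
Variables (K : fieldType) (lam : K).

Definition casimir_ideal : {pred {mpoly K[3]}} :=
  fun p => `[< exists q, p = q * (casimir K - lam%:MP) >].

Lemma casimir_ideal_closed : idealr_closed casimir_ideal.
Proof.
split; first by apply/asboolP; exists 0; rewrite mul0r.
  apply/negP => /asboolP [q /eqP].
  rewrite eq_sym; have [-> /eqP|q0] := eqVneq q 0.
    by rewrite mul0r => /esym/eqP; rewrite oner_eq0.
  pose m := (U_(iH) + U_(iH))%MM.
  have cm : (casimir K - lam%:MP)@_m = 1.
    rewrite mcoeffB mcoeffC /casimir expr2 -!mpolyXD mcoeffD mcoeffX eqxx.
    have -> : (m == 0%MM) = false.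
      by apply/eqP => /mnmP/(_ iH); rewrite !mnmE.
    rewrite mulr0 subr0 -mulrA mulr_natl mcoeffMn -mpolyXD mcoeffX.
    have -> : ((U_(iE) + U_(iF))%MM == m) = false.
      by apply/eqP => /mnmP/(_ iH); rewrite !mnmE.
    by rewrite mul0rn add0r.
  have cin : m \in msupp (casimir K - lam%:MP).
    by rewrite mcoeff_msupp cm oner_eq0.
  have c0 : casimir K - lam%:MP != 0.
    apply/eqP => c0; move: cm; rewrite c0 mcoeff0 => /esym/eqP.
    by rewrite oner_eq0.
  move=> /eqP q1; have := msizeM q0 c0; rewrite q1 msize1.
  have := msize_mdeg_lt cin; rewrite mdegD !mdeg1.
  have : msize q != 0%N by rewrite mmeasure_poly_eq0.
  case: (msize q) => // k _ s2; rewrite addSn /= => e.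
  by have := leq_trans s2 (leq_addl k _); rewrite -e.
move=> a p q /asboolP[p' ->] /asboolP[q' ->]; apply/asboolP.
by exists (a * p' + q'); rewrite mulrDl mulrA.
Qed.

HB.instance Definition _ :=
  isIdealr.Build {mpoly K[3]} casimir_ideal casimir_ideal_closed.

Definition P_lambda : Type := {ideal_quot casimir_ideal}.

HB.instance Definition _ := GRing.ComNzRing.on P_lambda.
HB.instance Definition _ := EqQuotient.on P_lambda.
HB.instance Definition _ := NzRingQuotient.on P_lambda.

Lemma P_lambda_eqP (p q : {mpoly K[3]}) :
  reflect (exists r, p - q = r * (casimir K - lam%:MP))
    (p == q %[mod P_lambda]).
Proof. by rewrite -(@Quotient.idealrBE _ casimir_ideal); apply: asboolP. Qed.

Definition P_lambda_scale (a : K) (x : P_lambda) : P_lambda :=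
  \pi_P_lambda (a%:MP_[3]) * x.

Lemma P_lambda_scaleA a b x :
  P_lambda_scale a (P_lambda_scale b x) = P_lambda_scale (a * b) x.
Proof. by rewrite /P_lambda_scale !rmorphM mulrA. Qed.
Lemma P_lambda_scale1 : left_id 1 P_lambda_scale.
Proof. by move=> x; rewrite /P_lambda_scale !rmorph1 mul1r. Qed.
Lemma P_lambda_scaleDr : right_distributive P_lambda_scale +%R.
Proof. by move=> a x y; rewrite /P_lambda_scale mulrDr. Qed.
Lemma P_lambda_scaleDl x : {morph P_lambda_scale^~ x : a b / a + b}.
Proof. by move=> a b; rewrite /P_lambda_scale !rmorphD mulrDl. Qed.

HB.instance Definition _ := GRing.Zmodule_isLmodule.Build K P_lambda
  P_lambda_scaleA P_lambda_scale1 P_lambda_scaleDr P_lambda_scaleDl.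

Lemma P_lambda_scaleAl (a : K) (x y : P_lambda) : a *: (x * y) = a *: x * y.
Proof. exact: mulrA. Qed.

HB.instance Definition _ :=
  GRing.Lmodule_isLalgebra.Build K P_lambda P_lambda_scaleAl.
HB.instance Definition _ := GRing.Lalgebra_isComAlgebra.Build K P_lambda.

Lemma pi_scale a p : \pi_P_lambda (a *: p) = a *: \pi_P_lambda p.
Proof. by rewrite -mul_mpolyC rmorphM. Qed.

Lemma pi_mpolyC a : \pi_P_lambda a%:MP = a%:A.
Proof. by rewrite -alg_mpolyC pi_scale rmorph1. Qed.

(* Independent of the representatives by pi_bracket. *)
Definition Pl_bracket (x y : P_lambda) : P_lambda :=
  \pi_P_lambda (P_bracket (repr x) (repr y)).

Lemma P_bracket_idealD r s t : exists u,
  P_bracket (r + s * (casimir K - lam%:MP)) t =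
  P_bracket r t + u * (casimir K - lam%:MP).
Proof.
have [PL _ PN _ PM] := P_bracket_poisson K.
have cC x : P_bracket (casimir K - lam%:MP) x = 0.
  by rewrite P_bracketE !mderivB !mderivC !subr0 -P_bracketE P_bracket_casimir.
exists (P_bracket s t).
rewrite addrC -[X in P_bracket (X + _)]scale1r PL scale1r addrC; congr (_ + _).
by rewrite PN PM [P_bracket t (_ - _)]PN cC oppr0 mulr0 addr0 -mulNr -PN.
Qed.

Lemma pi_bracket p q :
  \pi_P_lambda (P_bracket p q) = Pl_bracket (\pi p) (\pi q).
Proof.
have [_ _ PN _ _] := P_bracket_poisson K.
have rE r : exists s, repr (\pi_P_lambda r) = r + s * (casimir K - lam%:MP).
  have /P_lambda_eqP[s sE] : repr (\pi_P_lambda r) == r %[mod P_lambda].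
    by rewrite reprK.
  by exists s; rewrite -sE addrC subrK.
rewrite /Pl_bracket; have [s ->] := rE p; have [t ->] := rE q.
have [u ->] := P_bracket_idealD p s (q + t * (casimir K - lam%:MP)).
rewrite [P_bracket p (_ + _)]PN; have [w ->] := P_bracket_idealD q t p.
apply/esym/eqP/P_lambda_eqP; exists (u - w).
by rewrite [P_bracket q p]PN; ring.
Qed.

Lemma Pl_bracket_poisson : is_poisson_bracket Pl_bracket.
Proof.
have [PL PA PN PJ PM] := P_bracket_poisson K.
split=> [a x y z|x|x y|x y z|x y z].
- rewrite -[x]reprK -[y]reprK -[z]reprK -pi_scale -rmorphD /= -!pi_bracket.
  by rewrite PL rmorphD /= pi_scale.
- by rewrite -[x]reprK -pi_bracket PA rmorph0.
- by rewrite -[x]reprK -[y]reprK -!pi_bracket PN rmorphN.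
- have piJ p q r : Pl_bracket (\pi p) (Pl_bracket (\pi q) (\pi r)) =
    \pi_P_lambda (P_bracket p (P_bracket q r)) by rewrite !pi_bracket.
  have piD p q : \pi_P_lambda p + \pi_P_lambda q = \pi_P_lambda (p + q).
    by rewrite rmorphD.
  by rewrite -[x]reprK -[y]reprK -[z]reprK !piJ !piD PJ rmorph0.
- rewrite -[x]reprK -[y]reprK -[z]reprK -!pi_bracket -!rmorphM /= -!pi_bracket.
  by rewrite PM rmorphD !rmorphM.
Qed.

Definition Pl_gen (i : 'I_3) : P_lambda := \pi_P_lambda 'X_i.
Definition Pl_e := Pl_gen iE.
Definition Pl_h := Pl_gen iH.
Definition Pl_f := Pl_gen iF.

Lemma pi_lincomb u :
  \pi_P_lambda (lincomb (fun i => 'X_i) u) = lincomb Pl_gen u.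
Proof.
by rewrite /lincomb rmorph_sum; apply: eq_bigr => i _; rewrite /= pi_scale.
Qed.

Lemma Pl_bracket_lin u v :
  Pl_bracket (lincomb Pl_gen u) (lincomb Pl_gen v) =
  lincomb Pl_gen (sl2_bracket u v).
Proof. by rewrite -!pi_lincomb -pi_bracket P_bracket_lin. Qed.

Lemma lincomb_delta (V : lmodType K) (x : 'I_3 -> V) i :
  lincomb x (delta_mx 0 i) = x i.
Proof.
rewrite /lincomb (bigD1 i) //= big1 => [|j ji]; last first.
  by rewrite mxE (negPf ji) andbF scale0r.
by rewrite mxE !eqxx scale1r addr0.
Qed.

Lemma Pl_ef : Pl_bracket Pl_e Pl_f = Pl_h.
Proof.
rewrite /Pl_e /Pl_f -!(lincomb_delta Pl_gen) Pl_bracket_lin sl2_EF.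
exact: lincomb_delta.
Qed.

Lemma Pl_he : Pl_bracket Pl_h Pl_e = 2 *: Pl_e.
Proof.
rewrite /Pl_h /Pl_e -!(lincomb_delta Pl_gen) Pl_bracket_lin sl2_HE.
by rewrite /lincomb scaler_sumr; apply: eq_bigr => i _; rewrite mxE scalerA.
Qed.

Lemma Pl_hf : Pl_bracket Pl_h Pl_f = (- 2) *: Pl_f.
Proof.
rewrite /Pl_h /Pl_f -!(lincomb_delta Pl_gen) Pl_bracket_lin sl2_HF.
by rewrite /lincomb scaler_sumr; apply: eq_bigr => i _; rewrite mxE scalerA.
Qed.

Lemma Pl_casimir : 4 * Pl_e * Pl_f + Pl_h ^+ 2 = lam%:A.
Proof.
rewrite -pi_mpolyC /Pl_e /Pl_f /Pl_h /Pl_gen -(rmorph_nat \pi_P_lambda 4).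
rewrite -!rmorphM -rmorphXn -rmorphD /=.
by apply/eqP/P_lambda_eqP; exists 1; rewrite mul1r.
Qed.

End CasimirIdeal.

Section AlgebraEvaluation.
Variables (K : fieldType) (A : comAlgType K).

Lemma mpoly_alg_ind (n : nat) (R : comNzRingType) (Q : {mpoly R[n]} -> Prop) :
  (forall c, Q c%:MP) -> (forall i, Q 'X_i) ->
  (forall p q, Q p -> Q q -> Q (p + q)) ->
  (forall p q, Q p -> Q q -> Q (p * q)) -> forall p, Q p.
Proof.
move=> QC QX QD QM p; rewrite [p]mpolyE; apply: big_ind => //.
  by rewrite -mpolyC0; apply: QC.
move=> m _; rewrite -mul_mpolyC; apply: (QM) => //; rewrite mpolyXE_id.
apply: big_ind => [|x y|i _]; [by rewrite -mpolyC1; apply: QC|exact: QM|].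
by elim: (m i) => [|k IH]; rewrite ?expr0 -?mpolyC1 // exprS; apply: QM.
Qed.

Definition alg_eval (v : 'I_3 -> A) (p : {mpoly K[3]}) : A :=
  mmap (in_alg A) v p.

Lemma alg_evalX v i : alg_eval v 'X_i = v i.
Proof. by rewrite /alg_eval mmapX mmap1U. Qed.
Lemma alg_evalC v c : alg_eval v c%:MP = c%:A.
Proof. by rewrite /alg_eval mmapC. Qed.
Lemma alg_evalD v p q : alg_eval v (p + q) = alg_eval v p + alg_eval v q.
Proof. exact: rmorphD. Qed.
Lemma alg_evalN v p : alg_eval v (- p) = - alg_eval v p.
Proof. exact: rmorphN. Qed.
Lemma alg_evalM v p q : alg_eval v (p * q) = alg_eval v p * alg_eval v q.
Proof. exact: rmorphM. Qed.
Lemma alg_eval_nat v n : alg_eval v n%:R = n%:R.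
Proof. exact: rmorph_nat. Qed.

Lemma alg_eval_der v (D : A -> A) :
  (forall c, D c%:A = 0) -> (forall x y, D (x + y) = D x + D y) ->
  (forall x y, D (x * y) = D x * y + x * D y) ->
  forall p, D (alg_eval v p) = \sum_i alg_eval v p^`M(i) * D (v i).
Proof.
move=> D0 DD DM; apply: mpoly_alg_ind => [c|i|p q IHp IHq|p q IHp IHq].
- rewrite alg_evalC D0 big1 // => i _.
  by rewrite mderivC (alg_eval_nat v 0) mul0r.
- rewrite alg_evalX (bigD1 i) //= big1 => [|j ji].
    by rewrite mderivXU eqxx (alg_eval_nat v 1) mul1r addr0.
  by rewrite mderivXU eq_sym (negPf ji) (alg_eval_nat v 0) mul0r.
- rewrite alg_evalD DD IHp IHq -big_split /=; apply: eq_bigr => i _.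
  by rewrite mderivD alg_evalD mulrDl.
- rewrite alg_evalM DM IHp IHq mulr_suml mulr_sumr -big_split /=.
  apply: eq_bigr => i _; rewrite mderivM alg_evalD !alg_evalM; ring.
Qed.

Variables (br : A -> A -> A) (brP : is_poisson_bracket br).

Let PN x y : br x y = - br y x. Proof. by case: brP. Qed.
Let PA x : br x x = 0. Proof. by case: brP. Qed.
Let PM x y z : br x (y * z) = br x y * z + y * br x z.
Proof. by case: brP. Qed.
Let PD x y z : br x (y + z) = br x y + br x z.
Proof.
case: brP => PL _ _ _ _.
by rewrite PN [br x y]PN [br x z]PN -[y in LHS]scale1r PL scale1r opprD.
Qed.
Let PZl a x y : br (a *: x) y = a *: br x y.
Proof.
case: brP => PL _ _ _ _; have P0 : br 0 y = 0.
  by have := PL (-1) 0 0 y; rewrite scaler0 addr0 scaleN1r addNr.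
by rewrite -[a *: x]addr0 PL P0 addr0.
Qed.
Let PZr a x y : br x (a *: y) = a *: br x y.
Proof. by rewrite PN PZl -scalerN -PN. Qed.
Let PC x c : br x c%:A = 0.
Proof.
rewrite PZr (_ : br x 1 = 0) ?scaler0 //.
by apply: (addrI (br x 1)); rewrite addr0 -{3}[1]mulr1 PM mulr1 mul1r.
Qed.
Let PNr x y : br x (- y) = - br x y.
Proof. by rewrite -scaleN1r PZr scaleN1r. Qed.
Let PNl x y : br (- x) y = - br x y.
Proof. by rewrite -scaleN1r PZl scaleN1r. Qed.
Let P2 x : br x 2 = 0.
Proof. by rewrite -(PC x 2) scaler_nat. Qed.
Let PDl x y z : br (x + y) z = br x z + br y z.
Proof. by rewrite PN PD opprD -!PN. Qed.
Let PMl x y z : br (x * y) z = br x z * y + x * br y z.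
Proof. by rewrite PN PM opprD -mulNr -mulrN -!PN. Qed.

Definition sl2_relations (lam : K) (v : 'I_3 -> A) : Prop :=
  [/\ br (v iE) (v iF) = v iH, br (v iH) (v iE) = 2 * v iE,
      br (v iH) (v iF) = - (2 * v iF) &
      4 * v iE * v iF + v iH ^+ 2 = lam%:A].

Definition triple (a b c : A) (i : 'I_3) : A :=
  if i == iE then a else if i == iH then b else c.

Lemma alg_eval_bracket lam v : sl2_relations lam v ->
  forall p q, alg_eval v (P_bracket p q) = br (alg_eval v p) (alg_eval v q).
Proof.
move=> [vef vhe vhf _] p q.
rewrite (alg_eval_der v (PC _) (PD _) (PM _)).
have step i :
    br (alg_eval v p) (v i) = \sum_j alg_eval v p^`M(j) * br (v j) (v i).
  rewrite PN (alg_eval_der v (PC _) (PD _) (PM _)) -sumrN.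
  by apply: eq_bigr => j _; rewrite [br (v i) _]PN mulrN opprK.
rewrite !big_I3 !step !big_I3 !PA.
rewrite [br (v iF) (v iE)]PN [br (v iE) (v iH)]PN [br (v iF) (v iH)]PN.
rewrite vef vhe vhf P_bracketE.
by rewrite !(alg_evalD, alg_evalN, alg_evalM, alg_eval_nat) !alg_evalX; ring.
Qed.

Lemma alg_eval_casimir lam v : sl2_relations lam v ->
  alg_eval v (casimir K - lam%:MP) = 0.
Proof.
move=> [_ _ _ vC]; rewrite /casimir expr2.
rewrite !(alg_evalD, alg_evalN, alg_evalM, alg_eval_nat) !alg_evalX alg_evalC.
by rewrite -expr2 vC subrr.
Qed.

Lemma horner_alg_der (D : A -> A) (x : A) :
  (forall c, D c%:A = 0) -> (forall y z, D (y + z) = D y + D z) ->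
  (forall y z, D (y * z) = D y * z + y * D z) ->
  forall g, D (horner_alg x g) = horner_alg x g^`() * D x.
Proof.
move=> DC DD DM; elim/poly_ind => [|g c IH].
  by rewrite deriv0 !rmorph0 mul0r; have := DC 0; rewrite scale0r.
rewrite derivD derivM derivX derivC addr0 mulr1 !(rmorphD, rmorphM) /=.
by rewrite horner_algX horner_algC DD DC DM IH addr0 mulrDl; ring.
Qed.

Definition Delta_e (e h f : A) g :=
  e - horner_alg f g * h - f * horner_alg f g ^+ 2.
Definition Delta_h (h f : A) g := h + 2 * f * horner_alg f g.

Lemma Delta_relations lam v g : sl2_relations lam v ->
  sl2_relations lam
    (triple (Delta_e (v iE) (v iH) (v iF) g) (Delta_h (v iH) (v iF) g) (v iF)).
Proof.
case=> [ef he hf cas]; move: (v iE) (v iH) (v iF) ef he hf cas => e h f.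
move=> ef he hf cas; rewrite /sl2_relations /triple /= /Delta_e /Delta_h.
have gr x := @horner_alg_der (br x) f (PC x) (PD x) (PM x) g.
move: (horner_alg f g) (horner_alg f g^`()) gr => gf dg gr.
have gl x : br gf x = - (dg * br x f) by rewrite PN gr.
have eh : br e h = - (2 * e) by rewrite PN he.
have fh : br f h = 2 * f by rewrite PN hf opprK.
have fe : br f e = - h by rewrite PN ef.
have P2l x : br 2 x = 0 by rewrite PN P2 oppr0.
rewrite !expr2; split.
- by rewrite !(PDl, PNl, PMl) gl PA hf ef; ring.
- rewrite !(PDl, PNl, PMl, PD, PNr, PM, P2l, P2, gl, gr).
  by rewrite !(PA, fh, fe, hf, he, ef, eh); ring.
- by rewrite !(PDl, PNl, PMl, P2l) gl PA hf; ring.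
- by rewrite -cas expr2; ring.
Qed.

Lemma Delta_comp (a : A -> A) (e h f : A) g :
  linear a -> a 1 = 1 -> {morph a : x y / x * y} ->
  a e = Delta_e e h f g -> a h = Delta_h h f g -> a f = f ->
  a (Delta_e e h f (- g)) = e /\ a (Delta_h h f (- g)) = h.
Proof.
move=> la a1 aM ae ah af.
have aD : {morph a : x y / x + y}.
  by move=> x y; rewrite -[x]scale1r la !scale1r.
have a0 : a 0 = 0 by have := la (-1) 0 0; rewrite scaler0 addr0 scaleN1r addNr.
have aN x : a (- x) = - a x.
  by rewrite -[- x]addr0 -scaleN1r la a0 addr0 scaleN1r.
have ag k : a (horner_alg f k) = horner_alg f k.
  elim/poly_ind: k => [|k c IH]; first by rewrite rmorph0.
  rewrite rmorphD rmorphM /= horner_algX horner_algC aD aM IH af.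
  by rewrite -[c%:A]addr0 la a1 a0.
move: ae ah; rewrite /Delta_e /Delta_h !rmorphN /= => ae ah.
have := ag g; move: (horner_alg f g) ae ah => k ae ah ak.
by split; rewrite ?expr2 !(aD, aN, aM) ?a1 ?ae ?ah !af !ak ?expr2; ring.
Qed.

Lemma Hrot_relations lam v nu : nu != 0 -> sl2_relations lam v ->
  sl2_relations lam (triple (nu *: v iE) (v iH) (nu^-1 *: v iF)).
Proof.
move=> nu0 [ef he hf cas]; rewrite /sl2_relations /triple /=; split.
- by rewrite PZl PZr scalerA divff // scale1r.
- by rewrite PZr he -scalerAr.
- by rewrite PZr hf -scalerAr scalerN.
- by rewrite -!scalerAr -scalerAl scalerA mulVf // scale1r.
Qed.

End AlgebraEvaluation.

Section Morphisms.
Variables (K : fieldType) (lam : K).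
Local Notation P := (P_lambda lam).
Local Notation br := (@Pl_bracket K lam).

Definition is_poisson_endo (f : P -> P) : Prop :=
  [/\ linear f, f 1 = 1, {morph f : x y / x * y} & {morph f : x y / br x y}].

Lemma Pl_endo v : sl2_relations br lam v ->
  exists2 f, is_poisson_endo f & forall i, f (Pl_gen lam i) = v i.
Proof.
move=> vP; pose f (x : P) := alg_eval v (repr x).
have fpi p : f (\pi p) = alg_eval v p.
  rewrite /f; have /P_lambda_eqP[s sE] : repr (\pi_P p) == p %[mod P].
    by rewrite reprK.
  rewrite -[repr _](subrK p) sE alg_evalD alg_evalM.
  by rewrite (alg_eval_casimir vP) mulr0 add0r.
have fM : {morph f : x y / x * y}.
  by move=> x y; rewrite -[x]reprK -[y]reprK -(rmorphM \pi_P) /= !fpi alg_evalM.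
have fD : {morph f : x y / x + y}.
  move=> x y; rewrite -[x]reprK -[y]reprK.
  have <- : \pi_P (repr x + repr y) = \pi_P (repr x) + \pi_P (repr y).
    by rewrite rmorphD.
  by rewrite !fpi alg_evalD.
have fC c : f c%:A = c%:A by rewrite -pi_mpolyC fpi alg_evalC pi_mpolyC.
exists f; last by move=> i; rewrite /Pl_gen fpi alg_evalX.
split=> // [a x y||x y].
- by rewrite -[a *: x]mulr_algl fD fM fC mulr_algl.
- by have := fC 1; rewrite !scale1r.
rewrite -[x]reprK -[y]reprK -pi_bracket !fpi.
exact: (alg_eval_bracket (Pl_bracket_poisson lam) vP).
Qed.

Lemma Pl_gen_relations : sl2_relations br lam (Pl_gen lam).
Proof.
split; first exact: Pl_ef; last exact: Pl_casimir.
  by rewrite mulr_natl -scaler_nat; exact: Pl_he.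
by rewrite mulr_natl -scaler_nat -scaleNr; exact: Pl_hf.
Qed.

Lemma poisson_endo_ext f g : is_poisson_endo f -> is_poisson_endo g ->
  (forall i, f (Pl_gen lam i) = g (Pl_gen lam i)) -> f =1 g.
Proof.
move=> [lf f1 fM _] [lg g1 gM _] fg x; rewrite -[x]reprK.
have addf (h : P -> P) : linear h -> {morph h : x y / x + y}.
  by move=> lh y z; rewrite -[y]scale1r lh !scale1r.
have algf (h : P -> P) c : linear h -> h 1 = 1 -> h (c%:A) = c%:A.
  move=> lh h1; have h0 : h 0 = 0.
    by have := lh (-1) 0 0; rewrite scaler0 addr0 scaleN1r addNr.
  by rewrite -[c%:A]addr0 lh h0 h1.
elim/mpoly_alg_ind: (repr x) => [c|i|p q IHp IHq|p q IHp IHq].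
- by rewrite pi_mpolyC !algf.
- exact: fg.
- by rewrite rmorphD !addf ?IHp ?IHq.
- by rewrite rmorphM fM gM IHp IHq.
Qed.

Lemma poisson_endo_aut f g : is_poisson_endo f -> is_poisson_endo g ->
  (forall i, f (g (Pl_gen lam i)) = Pl_gen lam i) ->
  (forall i, g (f (Pl_gen lam i)) = Pl_gen lam i) -> is_poisson_aut br f.
Proof.
move=> hf hg fg gf.
have comp a b : is_poisson_endo a -> is_poisson_endo b ->
    is_poisson_endo (a \o b).
  move=> [la a1 aM aB] [lb b1 bM bB]; split=> [c x y||x y|x y] /=.
  - by rewrite lb la.
  - by rewrite b1 a1.
  - by rewrite bM aM.
  - by rewrite bB aB.
have hid : is_poisson_endo id by split.
have [lf f1 fM fB] := hf; split=> //; exists g.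
- exact: (poisson_endo_ext (comp _ _ hg hf) hid).
- exact: (poisson_endo_ext (comp _ _ hf hg) hid).
Qed.

End Morphisms.

Section MainGroups.
Variables (K : fieldType) (lam : K).
Local Notation P := (P_lambda lam).
Local Notation br := (@Pl_bracket K lam).
Local Notation e := (Pl_e lam).
Local Notation h := (Pl_h lam).
Local Notation f := (Pl_f lam).

Definition Aut_P_lambda : groupType := poisson_aut br.

Implicit Types s : Aut_P_lambda.

(* The image of Aut(sl_2(K)) in Aut(P_lambda), u being identified with the
   linear combination of e, h, f with coordinates u. *)
Definition linear_auts : set Aut_P_lambda :=
  [set s | exists2 phi, sl2_lie_aut phi &
     forall u, s (lincomb (Pl_gen lam) u) = lincomb (Pl_gen lam) (phi u)].

(* An automorphism is determined by its values at e, h, f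
   (poisson_endo_ext), so the next two predicates characterize Delta_g and
   H_nu, which exist by Delta_ex and Hrot_ex. *)
Definition is_Delta (g : {poly K}) s : Prop :=
  let gf := horner_alg f g in
  [/\ s e = e - gf * h - f * gf ^+ 2, s h = h + 2 * f * gf & s f = f].

Definition is_Hrot (nu : K) s : Prop :=
  [/\ s e = nu *: e, s h = h & s f = nu^-1 *: f].

Definition triangular_auts : set Aut_P_lambda :=
  generated [set s | (exists g, is_Delta g s) \/
                     (exists2 nu, nu != 0 & is_Hrot nu s)].

Let I3P (Q : 'I_3 -> Prop) : Q iE -> Q iH -> Q iF -> forall i, Q i.
Proof.
move=> QE QH QF [[|[|[|//]]] lti].
- by rewrite (_ : Ordinal lti = iE) //; exact: val_inj.
- by rewrite (_ : Ordinal lti = iH) //; exact: val_inj.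
- by rewrite (_ : Ordinal lti = iF) //; exact: val_inj.
Qed.

Lemma Delta_ex g : exists s, is_Delta g s.
Proof.
have endo k : exists2 F, is_poisson_endo F &
    [/\ F e = Delta_e e h f k, F h = Delta_h h f k & F f = f].
  have rk := Delta_relations (Pl_bracket_poisson lam) k (Pl_gen_relations lam).
  by have [F FP Fv] := Pl_endo rk; exists F => //; split; exact: Fv.
have [F FP [Fe Fh Ff]] := endo g; have [F' F'P [F'e F'h F'f]] := endo (- g).
suff FA : is_poisson_aut br F by exists (mk_paut FA).
apply: (poisson_endo_aut FP F'P); apply: I3P;
  rewrite -/(Pl_e lam) -/(Pl_h lam) -/(Pl_f lam) ?F'f ?Ff //.
- by rewrite F'e; have [lF F1 FM _] := FP; case: (Delta_comp lF F1 FM Fe Fh Ff).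
- by rewrite F'h; have [lF F1 FM _] := FP; case: (Delta_comp lF F1 FM Fe Fh Ff).
- rewrite Fe -[g in Delta_e _ _ _ g]opprK.
  by have [lF F1 FM _] := F'P; case: (Delta_comp lF F1 FM F'e F'h F'f).
- rewrite Fh -[g in Delta_h _ _ g]opprK.
  by have [lF F1 FM _] := F'P; case: (Delta_comp lF F1 FM F'e F'h F'f).
Qed.

Lemma Hrot_ex nu : nu != 0 -> exists s, is_Hrot nu s.
Proof.
have endo mu : mu != 0 -> exists2 F, is_poisson_endo F &
    [/\ F e = mu *: e, F h = h & F f = mu^-1 *: f].
  move=> mu0.
  have rk := Hrot_relations (Pl_bracket_poisson lam) mu0 (Pl_gen_relations lam).
  by have [F FP Fv] := Pl_endo rk; exists F => //; split; exact: Fv.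
move=> nu0; have [F FP [Fe Fh Ff]] := endo _ nu0.
have nu'0 : nu^-1 != 0 by rewrite invr_eq0.
have [F' F'P [F'e F'h F'f]] := endo _ nu'0.
have homZ (H : P -> P) a x : is_poisson_endo H -> H (a *: x) = a *: H x.
  move=> [lH _ _ _].
  have H0 : H 0 = 0.
    by have := lH (-1) 0 0; rewrite scaler0 addr0 scaleN1r addNr.
  by rewrite -[a *: x]addr0 lH H0 addr0.
have FA : is_poisson_aut br F.
  apply: (poisson_endo_aut FP F'P); apply: I3P;
    rewrite -/(Pl_e lam) -/(Pl_h lam) -/(Pl_f lam).
  - by rewrite F'e homZ // Fe scalerA mulVf // scale1r.
  - by rewrite F'h Fh.
  - by rewrite F'f homZ // Ff scalerA invrK divff // scale1r.
  - by rewrite Fe homZ // F'e scalerA divff // scale1r.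
  - by rewrite Fh F'h.
  - by rewrite Ff homZ // F'f scalerA invrK mulVf // scale1r.
by exists (mk_paut FA).
Qed.

End MainGroups.

Arguments linear_auts {K} lam _.
Arguments triangular_auts {K} lam _.

(* Main.v *)
(** Fix q with q^2 = lam. Since 4ef = (q - h)(q + h), the open set f <> 0 has
    the coordinate X = (h - q) / (2f), and e, h, f are polynomials in X and f
    (see [embE], [embH], [embF]): P_lambda becomes a Poisson subalgebra of
    K[X, f] with {X, f} = -1. There {f, .} is d/dX, Delta_g is X |-> X + g(f),
    and the linear automorphism omega : e |-> -f, h |-> -h, f |-> -e is the
    birational map X |-> -1/X, f |-> qX + fX^2.

    Generation. For an automorphism s, the derivation {s(f), .} is locally
    nilpotent. Taking leading monomials for any integer weights, for which the
    bracket multiplies X^r f^s and X^u f^v into (su - rv) X^(r+u-1) f^(s+v-1),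
    this strongly restricts the leading monomials of c = s(f). It shows that
    the coefficient of X^N, with N the X-degree of c, has degree N/2 in f. It
    also applies after a substitution f = Z^B, X |-> X + xi Z^A: every root of
    the polynomial attached to an edge of nonnegative slope of the Newton
    polygon of c at (N, N/2) has multiplicity > N/2, so there is a single root,
    which vanishes once c is normalized by some Delta_g (Tschirnhaus). So after
    Delta_g there is no such edge, which means that omega lowers the X-degree.
    When the X-degree is 0, s = Delta_g H_nu.

    Uniqueness. For the degree filtration of P_lambda, an element of A \ T
    maps c f^M + (lower) to c' (e - ah - a^2 f)^M + (lower), and an element of
    T \ A maps the latter to c'' f^(M') + (lower) with M' > M. So no
    alternating word of length >= 2 fixes f. *)

From HB Require Import structures.
Require Import Defs.
From mathcomp Require Import all_boot all_order all_algebra ring_quotient.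
From mathcomp Require Import ring zify.
From mathcomp Require Import boolp classical_sets mpoly.

Set Implicit Arguments.
Unset Strict Implicit.
Unset Printing Implicit Defensive.

(** * Reduced words in an amalgamated product *)

Section Amalgam.
Variables (G : groupType) (G1 G2 : set G).
Hypotheses (sub1 : is_subgroup G1) (sub2 : is_subgroup G2).
Local Open Scope group_scope.
Local Notation G0 := (G1 `&` G2)%classic.
Local Notation word := (seq (bool * G)).
Local Notation aeq := (@amalgam_eq G G1 G2 G0).
Local Notation aword := (@amalgam_word G G1 G2).

(** Alternation concerns adjacent letters only, and this is what [sorted] tests for a relation that
    is not transitive. *)
Definition reduced_word (w : word) : Prop :=
  (forall l, l \in w -> factor G1 G2 l.1 l.2 /\ ~ G0 l.2) /\
  sorted (fun l l' : bool * G => l.1 != l'.1) w.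

Lemma factor_sub b : is_subgroup (factor G1 G2 b).
Proof. by case: b. Qed.

Lemma amalgam_word_cat (u v : word) :
  aword (u ++ v) <-> aword u /\ aword v.
Proof.
split=> [uv|[hu hv] l]; last by rewrite mem_cat => /orP[/hu|/hv].
by split=> l lu; apply: uv; rewrite mem_cat lu ?orbT.
Qed.

Lemma amalgam_word_cons l (v : word) :
  aword (l :: v) <-> factor G1 G2 l.1 l.2 /\ aword v.
Proof.
split=> [lv|[hl hv] k]; last by rewrite inE => /orP[/eqP->|/hv].
split; first by apply: lv; rewrite mem_head.
by move=> k kv; apply: lv; rewrite inE kv orbT.
Qed.

(** The generating relations already carry a context on both sides, so a larger context is absorbed
    by reassociating concatenations. *)
Lemma amalgam_eq_ctx (u v w w' : word) :
  aeq w w' -> aeq (u ++ w ++ v) (u ++ w' ++ v).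
Proof.
move=> ww'; elim: ww' u v => {w w'}.
- by move=> w u v; apply: amalgam_refl.
- by move=> w w' _ IH u v; apply/amalgam_sym/IH.
- by move=> w w' w'' _ IH _ IH' u v; apply: amalgam_trans (IH u v) (IH' u v).
- move=> b u' v' u v; rewrite -!catA !cat_cons 2!(catA u u').
  exact: amalgam_one.
- move=> b x y u' v' hx hy u v; rewrite -!catA !cat_cons 2!(catA u u').
  exact: amalgam_mul.
- move=> c u' v' hc u v; rewrite -!catA !cat_cons 2!(catA u u').
  exact: amalgam_glue.
Qed.

Lemma word_val_cat (u v : word) : word_val (u ++ v) = word_val u * word_val v.
Proof. by rewrite /word_val big_cat. Qed.

Lemma word_val_cons l (v : word) : word_val (l :: v) = l.2 * word_val v.
Proof. by rewrite /word_val big_cons. Qed.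

Lemma amalgam_eq_val (w w' : word) : aeq w w' -> word_val w = word_val w'.
Proof.
elim=> {w w'} //.
- by move=> w w' w'' _ -> _ ->.
- by move=> b u v; rewrite !word_val_cat word_val_cons mul1g.
- by move=> b x y u v _ _; rewrite !word_val_cat !word_val_cons /= -!mulgA.
- by move=> c u v _; rewrite !word_val_cat !word_val_cons.
Qed.

Lemma amalgam_glue_eq b b' c (u v : word) : G0 c ->
  aeq (u ++ (b, c) :: v) (u ++ (b', c) :: v).
Proof.
move=> hc; case: b; case: b'; try exact: amalgam_refl.
  exact/amalgam_sym/amalgam_glue.
exact: amalgam_glue.
Qed.

Lemma G0_factor b c : G0 c -> factor G1 G2 b c.
Proof. by case=> c1 c2; case: b. Qed.

(** A letter of [G0] can be moved into the factor of a neighbour and multiplied with it; adjacent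
    letters of one factor can be multiplied directly. Length at least 2 guarantees that a neighbour
    exists. *)
Lemma amalgam_shorten (w : word) : aword w -> 1 < size w -> ~ reduced_word w ->
  exists w', [/\ aword w', aeq w w' & size w' < size w].
Proof.
move=> ww sw nred.
have merge b x y (u v : word) : w = u ++ (b, x) :: (b, y) :: v ->
    exists w', [/\ aword w', aeq w w' & size w' < size w].
  move=> wE; move: ww; rewrite wE => /amalgam_word_cat[hu].
  move=> /amalgam_word_cons[/= hx] /amalgam_word_cons[/= hy hv].
  exists (u ++ (b, x * y) :: v); split; last by rewrite !size_cat /= !addnS.
    apply/amalgam_word_cat; split=> //; apply/amalgam_word_cons; split=> //=.
    by have [_ M _] := factor_sub b; apply: M.
  exact: amalgam_mul.
have glue b c b' y (u v : word) : G0 c ->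
    w = u ++ (b, c) :: (b', y) :: v \/ w = u ++ (b', y) :: (b, c) :: v ->
    exists w', [/\ aword w', aeq w w' & size w' < size w].
  move=> hc wE; have fc d := @G0_factor d c hc.
  have [_ M _] := factor_sub b'.
  case: wE => wE; move: ww; rewrite wE => /amalgam_word_cat[hu];
    move=> /amalgam_word_cons[/= hx] /amalgam_word_cons[/= hy hv].
  - exists (u ++ (b', c * y) :: v); split.
    + apply/amalgam_word_cat; split=> //; apply/amalgam_word_cons; split=> //=.
      exact: M.
    + apply: amalgam_trans (amalgam_glue_eq b b' u _ hc) _.
      exact: amalgam_mul.
    + by rewrite !size_cat /= !addnS.
  - exists (u ++ (b', y * c) :: v); split.
    + apply/amalgam_word_cat; split=> //; apply/amalgam_word_cons; split=> //=.
      exact: M.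
    + have := amalgam_glue_eq b b' (u ++ [:: (b', y)]) v hc.
      rewrite -!catA /= => g; apply: amalgam_trans g _.
      exact: amalgam_mul.
    + by rewrite !size_cat /= !addnS.
have [[l lw l0]|no0] := pselect (exists2 l, l \in w & G0 l.2).
  have [u [v wE]] : exists u v, w = u ++ l :: v.
    by case/path.splitPr: lw => u v; exists u, v.
  case: v wE => [|[b' y] v] wE; last first.
    by apply: (glue l.1 l.2 b' y u v l0); left; rewrite wE; case: l {lw l0 wE}.
  (* Here [l] is the last letter, so the neighbour is taken on its left. *)
  case/lastP: u wE => [wE|u [b' y] wE]; first by rewrite wE in sw.
  apply: (glue l.1 l.2 b' y u [::] l0); right.
  by rewrite wE cat_rcons; case: l {lw l0 wE}.
have [srt|] := boolP (sorted (fun l l' : bool * G => l.1 != l'.1) w).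
  case: nred; split=> // l lw; split; first exact: ww.
  by move=> l0; apply: no0; exists l.
have adj (v : word) : ~~ sorted (fun l l' : bool * G => l.1 != l'.1) v ->
    exists u v' b x y, v = u ++ (b, x) :: (b, y) :: v'.
  elim: v => [//|[b x] [//|[b' y] v] IH] /=; rewrite negb_and negbK.
  case: eqP => [->|_] /=; first by exists [::], v, b', x, y.
  by case/IH=> u [v' [c [x' [y' ->]]]]; exists ((b, x) :: u), v', c, x', y'.
by case/adj=> u [v [b [x [y wE]]]]; apply: merge wE.
Qed.

Lemma amalgam_reduce (w : word) : aword w ->
  exists w', [/\ aword w', aeq w w' & size w' <= 1 \/ reduced_word w'].
Proof.
have [n] := ubnP (size w); elim: n w => // n IH w sw ww.
have [s1|s1] := leqP (size w) 1.
  by exists w; split=> //; [exact: amalgam_refl|left].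
have [wr|wr] := pselect (reduced_word w).
  by exists w; split=> //; [exact: amalgam_refl|right].
have [w' [w'w ww' sw']] := amalgam_shorten ww s1 wr.
have [|w'' [w''w w'w'' nw]] := IH w' _ w'w.
  by rewrite ltnS in sw; apply: leq_trans sw' sw.
by exists w''; split=> //; apply: amalgam_trans ww' w'w''.
Qed.

Definition inv_word (w : word) : word := rev [seq (l.1, l.2^-1) | l <- w].

Lemma inv_word_cons l (w : word) :
  inv_word (l :: w) = inv_word w ++ [:: (l.1, l.2^-1)].
Proof. by rewrite /inv_word /= rev_cons -cats1. Qed.

Lemma inv_word_amalgam (w : word) : aword w -> aword (inv_word w).
Proof.
move=> ww l; rewrite mem_rev => /mapP[k kw ->] /=.
by have [_ _ V] := factor_sub k.1; apply/V/ww.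
Qed.

Lemma amalgam_eq_Vmul (w : word) : aword w -> aeq (inv_word w ++ w) [::].
Proof.
elim: w => [_|[b x] w IH] /=; first exact: amalgam_refl.
move=> /amalgam_word_cons[/= hx hw]; rewrite inv_word_cons /= -catA /=.
have [_ _ V] := factor_sub b.
apply: amalgam_trans (amalgam_mul _ _ _ (V _ hx) hx) _.
rewrite mulVg; apply: amalgam_trans (amalgam_one _ _ _ _ _ _) _; exact: IH.
Qed.

Lemma word_val_inv (w : word) : word_val (inv_word w) = (word_val w)^-1.
Proof.
elim: w => [|l w IH]; first by rewrite /word_val /inv_word !big_nil invg1.
by rewrite inv_word_cons word_val_cat IH !word_val_cons /word_val big_nil mulg1
  invgM.
Qed.

(** Injectivity is tested on the kernel: w followed by the inverse of w' has value 1, and since the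
    hypothesis excludes long reduced words, it reduces to a word of length at most 1. *)
Lemma amalgam_injective :
  (forall w, reduced_word w -> 1 < size w -> word_val w <> 1) ->
  forall w w', aword w -> aword w' -> word_val w = word_val w' -> aeq w w'.
Proof.
move=> red w w' hw hw' vw.
have triv (v : word) : aword v -> word_val v = 1 -> aeq v [::].
  move=> hv v1; have [v' [hv' vv' nv']] := amalgam_reduce hv.
  apply: (amalgam_trans vv'); move: (amalgam_eq_val vv'); rewrite v1.
  (* A word of length 1 and value 1 is the letter [(b, 1)], which [amalgam_one] erases. *)
  case: v' {hv' vv'} nv' => [_ _|[b x] [_|k v']]; first exact: amalgam_refl.
    rewrite word_val_cons /word_val big_nil mulg1 /= => <-.
    exact: (amalgam_one _ _ _ b [::] [::]).
  by case=> // /red v'1 /esym v'E; case: (v'1 isT).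
have wV := inv_word_amalgam hw'.
have ww' : aeq (w ++ inv_word w') [::].
  apply: triv; first by apply/amalgam_word_cat.
  by rewrite word_val_cat word_val_inv vw mulgV.
(* Modulo the congruence, w = w (w'^-1 w') = (w w'^-1) w' = w'. *)
have := amalgam_eq_ctx w [::] (amalgam_eq_Vmul hw').
rewrite !cats0 => /amalgam_sym /amalgam_trans; apply.
by have := amalgam_eq_ctx [::] w' ww'; rewrite /= catA.
Qed.

End Amalgam.

Import Order.TTheory GRing.Theory Num.Theory.
Local Open Scope ring_scope.
Local Open Scope quotient_scope.

(** * Leading monomials and the Jacobian bracket *)

Section Bivariate.
Variable K : fieldType.
Hypothesis charK0 : [pchar K] =i pred0.
Local Notation R := {poly {poly K}}.
Implicit Types (a b c p q z : R) (r s u v i j : nat).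

(* In {poly {poly K}} the outer variable is X, the inner one is f (or Z). *)
Definition dZ p : R := map_poly (@deriv K) p.

(** The Poisson bracket of K[X, f] normalized by {f, X} = 1. *)
Definition jac a b : R := dZ a * b^`() - a^`() * dZ b.

Lemma coef_dZ p i : (dZ p)`_i = (p`_i)^`().
Proof. by rewrite coef_map. Qed.

Lemma dZD p q : dZ (p + q) = dZ p + dZ q.
Proof. by apply/polyP => i; rewrite coefD !coef_dZ coefD derivD. Qed.

Lemma dZM p q : dZ (p * q) = dZ p * q + p * dZ q.
Proof.
apply/polyP => i; rewrite coefD coef_dZ !coefM linear_sum -big_split /=.
by apply: eq_bigr => j _; rewrite derivM !coef_dZ.
Qed.

Lemma dZC (k : {poly K}) : dZ k%:P = (k^`())%:P.
Proof. by apply/polyP => i; rewrite coef_dZ !coefC; case: eqP;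
  rewrite ?deriv0. Qed.

Lemma dZX : dZ 'X = 0.
Proof.
by apply/polyP => i; rewrite coef_dZ coefX coef0; case: eqP => _;
  rewrite ?deriv0 ?derivC.
Qed.

(** The Euler operators are diagonal on monomials, so that brackets can be compared coefficientwise
    without lowering exponents. *)
Definition eulerX p : R := 'X * p^`().
Definition eulerZ p : R := 'X%:P * dZ p.

Lemma coef_eulerX p u v : (eulerX p)`_u`_v = u%:R * p`_u`_v.
Proof.
rewrite /eulerX coefXM; case: u => [|u] /=; first by rewrite coef0 mul0r.
by rewrite coef_deriv coefMn mulr_natl.
Qed.

Lemma coef_eulerZ p u v : (eulerZ p)`_u`_v = v%:R * p`_u`_v.
Proof.
rewrite /eulerZ coefCM coef_dZ coefXM; case: v => [|v] /=;
  first by rewrite mul0r.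
by rewrite coef_deriv mulr_natl.
Qed.

Lemma jac_euler a b : 'X * ('X)%:P * jac a b =
  eulerZ a * eulerX b - eulerX a * eulerZ b.
Proof. by rewrite /jac /eulerZ /eulerX; ring. Qed.

Lemma coef2M p q u v : (p * q)`_u`_v =
  \sum_(i < u.+1) \sum_(j < v.+1) p`_i`_j * q`_(u - i)`_(v - j).
Proof. by rewrite coefM coef_sum; apply: eq_bigr => i _; rewrite coefM. Qed.

Variables al be : int.

Definition wt u v : int := al * u%:Z + be * v%:Z.

(** The coefficient at (u, v) itself may vanish, so the property survives subtraction and the Euler
    operators; nonvanishing is added in [leading]. *)
Definition dominated p u v : Prop := forall u' v',
  p`_u'`_v' != 0 -> (u', v') <> (u, v) -> wt u' v' < wt u v.

Definition leading p u v : Prop := p`_u`_v != 0 /\ dominated p u v.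

Lemma wtD u v r s : wt (u + r) (v + s) = wt u v + wt r s.
Proof. by rewrite /wt !PoszD; ring. Qed.

Lemma dominatedB p q u v :
  dominated p u v -> dominated q u v -> dominated (p - q) u v.
Proof.
move=> dp dq u' v'; rewrite !coefB.
have [->|p0 _] := eqVneq p`_u'`_v' 0; last exact: dp.
by rewrite sub0r oppr_eq0; apply: dq.
Qed.

Lemma dominated_eulerX p u v : dominated p u v -> dominated (eulerX p) u v.
Proof.
by move=> dp u' v'; rewrite coef_eulerX mulf_eq0 negb_or => /andP[_]; apply: dp.
Qed.

Lemma dominated_eulerZ p u v : dominated p u v -> dominated (eulerZ p) u v.
Proof.
by move=> dp u' v'; rewrite coef_eulerZ mulf_eq0 negb_or => /andP[_]; apply: dp.
Qed.

Lemma dominated_le p u v u' v' : dominated p u v -> p`_u'`_v' != 0 ->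
  wt u' v' <= wt u v.
Proof.
move=> dp p0; case: ((u', v') =P (u, v)) => [[-> ->] | ] //.
by move/(dp _ _ p0)/ltW.
Qed.

Lemma dominatedM p q u v r s : dominated p u v -> dominated q r s ->
  dominated (p * q) (u + r) (v + s).
Proof.
move=> dp dq u' v' pq ne; move: pq; apply: contraNT; rewrite -leNgt => le.
rewrite coef2M big1 // => i _; apply: big1 => j _; apply/eqP/negbNE/negP.
rewrite mulf_eq0 negb_or => /andP[pij qij].
have iE : (i + (u' - i) = u')%N by rewrite subnKC // -ltnS.
have jE : (j + (v' - j) = v')%N by rewrite subnKC // -ltnS.
move: le; rewrite -iE -jE !wtD.
case: (((i : nat), (j : nat)) =P (u, v)) => [[ui vj]|nij].
  rewrite ui vj in iE jE qij *; rewrite lerD2l leNgt => /negP; apply.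
  by apply: dq => //; case=> e1 e2; apply: ne; rewrite -iE -jE e1 e2.
have := dp _ _ pij nij; have := dominated_le dq qij.
lia.
Qed.

Lemma coef2M_top p q u v r s : dominated p u v -> dominated q r s ->
  (p * q)`_(u + r)`_(v + s) = p`_u`_v * q`_r`_s.
Proof.
move=> dp dq; have lu : (u < (u + r).+1)%N by rewrite ltnS leq_addr.
have lv : (v < (v + s).+1)%N by rewrite ltnS leq_addr.
have zero i j : (i <= u + r)%N -> (j <= v + s)%N -> (i, j) <> (u, v) ->
    p`_i`_j * q`_(u + r - i)`_(v + s - j) = 0.
  move=> li lj nij; apply/eqP/negbNE/negP; rewrite mulf_eq0 negb_or.
  move=> /andP[pij qij]; have := dp _ _ pij nij; have := dominated_le dq qij.
  have := wtD i j (u + r - i) (v + s - j); rewrite !subnKC // wtD; lia.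
rewrite coef2M (bigD1 (Ordinal lu)) //= (bigD1 (Ordinal lv)) //=.
rewrite big1 ?addr0 => [|j nj]; last first.
  by apply: zero; [exact: leq_addr|rewrite -ltnS|case=> e; case/eqP: nj;
    apply: val_inj].
rewrite big1 ?addr0 ?addKn // => i ni; apply: big1 => j _.
apply: zero; [by rewrite -ltnS|by rewrite -ltnS|case=> e _].
by case/eqP: ni; apply: val_inj.
Qed.

Lemma natf_eq0 n : (n%:R == 0 :> K) = (n == 0%N).
Proof. by have /pcharf0P-> := charK0. Qed.

Lemma natf_inj m n : m%:R = n%:R :> K -> m = n.
Proof.
wlog le : m n / (m <= n)%N => [hw e|].
  by have [le|/ltnW le] := leqP m n; [|symmetry]; apply: hw.
move/esym/eqP; rewrite -subr_eq0 -natrB // natf_eq0 subn_eq0 => le'.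
by apply/eqP; rewrite eqn_leq le.
Qed.

(** Multiplication by XZ expresses the bracket through Euler operators. The top coefficient is then
    (su - rv) times the product of the two leading coefficients, and characteristic 0 keeps su - rv
    nonzero in K. *)
Lemma leading_jac c z r s u v : leading c r s -> leading z u v ->
  (s * u)%N <> (r * v)%N ->
  leading ('X * ('X)%:P * jac c z) (r + u) (s + v).
Proof.
move=> [c0 dc] [z0 dz] ne; rewrite jac_euler; split; last first.
  apply: dominatedB; apply: dominatedM;
    by [exact: dominated_eulerX|exact: dominated_eulerZ].
rewrite !coefB !coef2M_top;
  do ?[exact: dominated_eulerX|exact: dominated_eulerZ].
rewrite !coef_eulerX !coef_eulerZ.
have -> : s%:R * c`_r`_s * (u%:R * z`_u`_v) - r%:R * c`_r`_s * (v%:R * z`_u`_v)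
   = ((s * u)%:R - (r * v)%:R) * (c`_r`_s * z`_u`_v) :> K.
  by rewrite !natrM; ring.
rewrite !mulf_neq0 // subr_eq0; apply/eqP => e; exact/ne/natf_inj.
Qed.

(** Undoes the multiplication by X Z^d. The bounds on u and v make the truncated subtractions
    exact. *)
Lemma leading_shift p d u v : leading ('X * ('X^d)%:P * p) u v ->
  [/\ (0 < u)%N, (d <= v)%N & leading p u.-1 (v - d)].
Proof.
have cfS u' v' : ('X * ('X^d)%:P * p)`_u'`_v' =
    if (u' == 0%N) || (v' < d)%N then 0 else p`_u'.-1`_(v' - d).
  rewrite -mulrA coefXM; case: u' => [|u'] /=; first by rewrite coef0.
  by rewrite coefCM coefXnM.
case=> nz dm; have := nz; rewrite cfS; case: ifP; rewrite ?eqxx //.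
move/negbT; rewrite negb_or -leqNgt -lt0n => /andP[u0 dv] nz'; split=> //.
split=> // u' v' nzp ne.
have := dm u'.+1 (v' + d)%N; rewrite cfS ltnNge leq_addl /= addnK => /(_ nzp).
have := wtD u'.-1 v' 1 d; have := wtD u.-1 (v - d) 1 d.
have := wtD u' v' 1 d; rewrite addn1 => -> .
rewrite addn1 prednK // subnK // => -> _.
rewrite ltrD2r; apply => -[e1 e2]; apply: ne; congr pair; lia.
Qed.

(* The leading monomial of z i is forced to be X^(u + i (r - 1))
   Z^(v + i (s - d)) as long as no coefficient s u_i - r v_i vanishes. *)
Lemma nilpotent_leading c (z : nat -> R) (k : K) d r s u v M :
  k != 0 -> (0 < d)%N ->
  (forall i, ('X^(d.-1))%:P * z i.+1 = k%:P%:P * jac c (z i)) ->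
  leading c r s -> leading (z 0%N) u v -> z M = 0 ->
  exists i : nat,
    s%:Z * u%:Z - r%:Z * v%:Z + i%:Z * (r%:Z * d%:Z - s%:Z) = 0.
Proof.
move=> k0 d0 zS lc lz zM; apply: contrapT => nex.
suff H i : exists ui vi, [/\ leading (z i) ui vi,
    ui%:Z = u%:Z + i%:Z * (r%:Z - 1) & vi%:Z = v%:Z + i%:Z * (s%:Z - d%:Z)].
  by have [ui [vi [[]]]] := H M; rewrite zM !coef0 eqxx.
elim: i => [|i [ui [vi [li uE vE]]]]; first by exists u, v; split=> //; lia.
have ne : (s * ui)%N <> (r * vi)%N.
  move=> e; apply: nex; exists i; have : (s%:Z * ui%:Z = r%:Z * vi%:Z) by lia.
  rewrite uE vE => e'; have -> : s%:Z * u%:Z - r%:Z * v%:Z + i%:Z *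
    (r%:Z * d%:Z - s%:Z) =
     s%:Z * (u%:Z + i%:Z * (r%:Z - 1)) - r%:Z * (v%:Z + i%:Z * (s%:Z - d%:Z))
       by ring.
  by rewrite e' subrr.
have lj := leading_jac lc li ne.
(* The factor Z^(d-1) accounts for a substitution f = Z^d; multiplication by XZ turns it into X
   Z^d. *)
have zSi : k%:P%:P * ('X * ('X)%:P * jac c (z i)) = 'X * ('X^d)%:P * z i.+1.
  rewrite mulrCA -zS mulrA -{2}(prednK d0) exprS polyCM; ring.
have : leading ('X * ('X^d)%:P * z i.+1) (r + ui) (s + vi).
  rewrite -zSi; case: lj => nz dm; split; first by rewrite !coefCM mulf_neq0.
  by move=> u' v'; rewrite !coefCM mulf_eq0 negb_or => /andP[_]; apply: dm.
case/leading_shift => h1 h2 l'; exists (r + ui).-1, (s + vi - d)%N.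
by split=> //; lia.
Qed.

End Bivariate.

(** * The embedding of P_lambda in K[X, f] *)

Section PoissonAutMorphism.
Variables (K : fieldType) (P : comAlgType K) (br : P -> P -> P).
Variable s : poisson_aut br.

Lemma paut_linear : linear s.
Proof. by case: (pautP s). Qed.
HB.instance Definition _ := GRing.isLinear.Build K P P _ s paut_linear.

Lemma paut_monoid : monoid_morphism s.
Proof. by case: (pautP s). Qed.
HB.instance Definition _ := GRing.isMonoidMorphism.Build P P s paut_monoid.

Lemma paut_br : {morph s : x y / br x y}.
Proof. by case: (pautP s). Qed.

Lemma pautKV x : s ((s^-1)%g x) = x.
Proof. by rewrite -paut_mulE mulgV. Qed.

Lemma pautVK x : (s^-1)%g (s x) = x.
Proof. by rewrite -paut_mulE mulVg. Qed.

Lemma paut_inj : injective s.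
Proof. exact: can_inj pautVK. Qed.

Lemma paut_algC c : s c%:A = c%:A.
Proof. by rewrite linearZ rmorph1. Qed.

End PoissonAutMorphism.

(** * Induction on [P_lambda] and its universal property *)

Section Quotient.
Variables (K : fieldType) (lam : K).
Local Notation P := (P_lambda lam).
Local Notation e := (Pl_e lam).
Local Notation h := (Pl_h lam).
Local Notation f := (Pl_f lam).

Lemma I3_ind (Q : 'I_3 -> Prop) : Q iE -> Q iH -> Q iF -> forall i, Q i.
Proof.
move=> QE QH QF [[|[|[|//]]] lti].
- by rewrite (_ : Ordinal lti = iE) //; exact: val_inj.
- by rewrite (_ : Ordinal lti = iH) //; exact: val_inj.
- by rewrite (_ : Ordinal lti = iF) //; exact: val_inj.
Qed.

Lemma Pl_ind (Q : P -> Prop) :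
  (forall c, Q c%:A) -> Q e -> Q h -> Q f ->
  (forall x y, Q x -> Q y -> Q (x + y)) ->
  (forall x y, Q x -> Q y -> Q (x * y)) -> forall x, Q x.
Proof.
move=> QC Qe Qh Qf QD QM x; rewrite -[x]reprK.
elim/mpoly_alg_ind: (repr x) => [c|i|p r IHp IHr|p r IHp IHr].
- by rewrite pi_mpolyC.
- by move: i; apply: I3_ind.
- by rewrite rmorphD; apply: QD.
- by rewrite rmorphM; apply: QM.
Qed.

Lemma Pl_hom_ext (S : nzRingType) (F G : {rmorphism P -> S}) :
  (forall c, F c%:A = G c%:A) -> F e = G e -> F h = G h -> F f = G f -> F =1 G.
Proof.
move=> FC Fe Fh Ff; apply: Pl_ind => // x y IHx IHy.
  by rewrite !rmorphD IHx IHy.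
by rewrite !rmorphM IHx IHy.
Qed.

(** Scalars enter through a ring morphism g, so that {poly {poly K}} can be a target without being
    given a K-algebra structure. *)
Lemma Pl_hom_ex (S : comNzRingType) (g : {rmorphism K -> S}) (a b c : S) :
  4 * a * c + b ^+ 2 = g lam ->
  exists F : {rmorphism P -> S},
    [/\ forall k, F k%:A = g k, F e = a, F h = b & F f = c].
Proof.
move=> rel; pose v (i : 'I_3) := if i == iE then a else if i ==
  iH then b else c.
pose F0 : {rmorphism {mpoly K[3]} -> S} := mmap g v.
have F0X i : F0 'X_i = v i by rewrite /= mmapX mmap1U.
have F0C k : F0 k%:MP = g k by rewrite /= mmapC.
have F0cas : F0 (casimir K - lam%:MP) = 0.
  rewrite /casimir rmorphB rmorphD !rmorphM rmorph_nat.
  by rewrite !F0X F0C -rel expr2 subrr.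
pose F (x : P) := F0 (repr x).
have Fpi p : F (\pi p) = F0 p.
  rewrite /F; have /P_lambda_eqP[s sE] : repr (\pi_(P_lambda lam) p) ==
    p %[mod P].
    by rewrite reprK.
  rewrite -[repr _](subrK p) sE rmorphD rmorphM.
  by rewrite F0cas mulr0 add0r.
have FB : zmod_morphism F.
  move=> x y; rewrite -[x]reprK -[y]reprK.
  have <- : \pi_P (repr x - repr y) = \pi_P (repr x) - \pi_P (repr y).
    by rewrite rmorphB.
  by rewrite !Fpi rmorphB.
have FM : monoid_morphism F.
  split=> [|x y]; first by rewrite -(rmorph1 \pi_P) Fpi rmorph1.
  by rewrite -[x]reprK -[y]reprK -(rmorphM \pi_P) /= !Fpi rmorphM.
pose fA := GRing.isZmodMorphism.Build _ _ F FB.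
pose fM := GRing.isMonoidMorphism.Build _ _ F FM.
pose FF : {rmorphism P -> S} := HB.pack F fA fM.
exists FF; split=> [k|||] /=; rewrite ?/Pl_e ?/Pl_h ?/Pl_f ?/Pl_gen ?Fpi ?F0X
  //.
by rewrite -pi_mpolyC Fpi F0C.
Qed.

End Quotient.

(** * Derivation rules for the bracket of [P_lambda] *)

Section Bracket.
Variables (K : fieldType) (lam : K).
Local Notation P := (P_lambda lam).
Local Notation br := (@Pl_bracket K lam).
Implicit Types x y z : P.

Lemma brN x y : br x y = - br y x.
Proof. by case: (Pl_bracket_poisson lam). Qed.

Lemma brMr x y z : br x (y * z) = br x y * z + y * br x z.
Proof. by case: (Pl_bracket_poisson lam). Qed.

Lemma brPl a x y z : br (a *: x + y) z = a *: br x z + br y z.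
Proof. by case: (Pl_bracket_poisson lam). Qed.

Lemma brxx x : br x x = 0.
Proof. by case: (Pl_bracket_poisson lam). Qed.

Lemma brDl x y z : br (x + y) z = br x z + br y z.
Proof. by rewrite -[x]scale1r brPl !scale1r. Qed.

Lemma br0l x : br 0 x = 0.
Proof. by apply: (addrI (br 0 x)); rewrite -brDl !addr0. Qed.

Lemma brZl a x y : br (a *: x) y = a *: br x y.
Proof. by rewrite -[a *: x]addr0 brPl br0l addr0. Qed.

Lemma brMl x y z : br (x * y) z = br x z * y + x * br y z.
Proof. by rewrite brN brMr opprD -mulNr -mulrN -!brN. Qed.

Lemma brDr x y z : br x (y + z) = br x y + br x z.
Proof. by rewrite brN brDl opprD -!brN. Qed.

Lemma brCl c x : br c%:A x = 0.
Proof.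
rewrite brZl (_ : br 1 x = 0) ?scaler0 //.
by apply: (addrI (br 1 x)); rewrite addr0 -{3}[1]mulr1 brMl mulr1 mul1r.
Qed.

Lemma brCr c x : br x c%:A = 0.
Proof. by rewrite brN brCl oppr0. Qed.

End Bracket.

(** * Poisson compatibility and injectivity of the embedding *)

Section Embedding.
Variables (K : fieldType) (lam q : K).
Hypothesis charK0 : [pchar K] =i pred0.
Local Notation P := (P_lambda lam).
Local Notation R := {poly {poly K}}.
Local Notation e := (Pl_e lam).
Local Notation h := (Pl_h lam).
Local Notation f := (Pl_f lam).
Local Notation br := (@Pl_bracket K lam).

Definition embF : R := 'X%:P.
Definition embH : R := q%:P%:P + 2 * embF * 'X.
Definition embE : R := - ('X * (q%:P%:P + embF * 'X)).

Definition is_embedding (emb : {rmorphism P -> R}) :=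
  [/\ forall k, emb k%:A = k%:P%:P, emb e = embE, emb h = embH & emb f = embF].

Lemma embedding_ex : q ^+ 2 = lam -> exists emb, is_embedding emb.
Proof.
move=> qE; have rel : 4 * embE * embF + embH ^+ 2 =
    ((polyC \o polyC) : {rmorphism K -> R}) lam.
  by rewrite /= -qE /embE /embH /embF !rmorphXn /=; ring.
by have [F FP] := Pl_hom_ex rel; exists F.
Qed.

Variable emb : {rmorphism P -> R}.
Hypothesis embP : is_embedding emb.

Lemma embC k : emb k%:A = k%:P%:P. Proof. by case: embP. Qed.
Lemma emb_e : emb e = embE. Proof. by case: embP. Qed.
Lemma emb_h : emb h = embH. Proof. by case: embP. Qed.
Lemma emb_f : emb f = embF. Proof. by case: embP. Qed.

Lemma embZ k x : emb (k *: x) = k%:P%:P * emb x.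
Proof. by rewrite -mulr_algl rmorphM embC. Qed.

Lemma emb_horner r : emb (horner_alg f r) = r%:P.
Proof.
elim/poly_ind: r => [|r c IH]; first by rewrite !rmorph0.
by rewrite !rmorphD !rmorphM /= horner_algX horner_algC IH emb_f embC.
Qed.

Lemma jacDl (a b c : R) : jac (a + b) c = jac a c + jac b c.
Proof. by rewrite /jac dZD derivD; ring. Qed.
Lemma jacMl (a b c : R) : jac (a * b) c = jac a c * b + a * jac b c.
Proof. by rewrite /jac dZM derivM; ring. Qed.
Lemma jacN (a b : R) : jac a b = - jac b a.
Proof. by rewrite /jac; ring. Qed.
Lemma jacC (k : K) (a : R) : jac k%:P%:P a = 0.
Proof. by rewrite /jac dZC !derivC mul0r mul0r subrr. Qed.

Lemma jacDr (a b c : R) : jac c (a + b) = jac c a + jac c b.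
Proof. by rewrite /jac dZD derivD; ring. Qed.
Lemma jacMr (a b c : R) : jac c (a * b) = jac c a * b + a * jac c b.
Proof. by rewrite /jac dZM derivM; ring. Qed.
Lemma jacNr (a b : R) : jac a (- b) = - jac a b.
Proof. by rewrite -mulN1r jacMr -(polyCN 1) -polyCN jacN jacC; ring. Qed.
Lemma jacCr (k : K) (a : R) : jac a k%:P%:P = 0.
Proof. by rewrite jacN jacC oppr0. Qed.
Lemma jac2r (a : R) : jac a 2 = 0.
Proof. by rewrite -[2](polyC_natr {poly K} 2) -polyC_natr jacCr. Qed.
Lemma jacxx (a : R) : jac a a = 0.
Proof. by rewrite /jac mulrC subrr. Qed.
Lemma jacFX : jac embF 'X = 1.
Proof. by rewrite /jac /embF dZC !derivX dZX derivC mul0r subr0 mulr1. Qed.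
Lemma jacFE (a : R) : jac embF a = a^`().
Proof. by rewrite /jac /embF dZC !derivC derivX mul1r mul0r subr0. Qed.
Lemma jacXF : jac 'X embF = -1.
Proof. by rewrite jacN jacFX. Qed.

Definition jac_simp := (jacDl, jacMl, jacDr, jacMr, jacNr, jacCr, jac2r, jacxx,
  jacFX, jacXF, jacC).

Lemma jac_HF : jac embH embF = - (2 * embF).
Proof.
by rewrite jacN /embH !jac_simp; ring.
Qed.

Lemma jac_EF : jac embE embF = embH.
Proof.
by rewrite jacN /embE /embH !jac_simp; ring.
Qed.

Lemma jac_HE : jac embH embE = 2 * embE.
Proof.
by rewrite /embE /embH !jac_simp; ring.
Qed.

Lemma br_ef : br e f = h.
Proof. exact: Pl_ef. Qed.
Lemma br_he : br h e = 2 * e.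
Proof. by rewrite [LHS]Pl_he scaler_nat mulr_natl. Qed.
Lemma br_hf : br h f = - (2 * f).
Proof. by rewrite [LHS]Pl_hf scaleNr scaler_nat mulr_natl. Qed.

Lemma emb_br x y : emb (br x y) = jac (emb x) (emb y).
Proof.
(* Both sides are derivations in the first argument, so for fixed z the generators suffice. This is
   applied with z = f, h, e in turn, then with z arbitrary, each stage supplying values for the
   next. *)
have gen (z : P) : emb (br z e) = jac (emb z) embE ->
    emb (br z h) = jac (emb z) embH -> emb (br z f) = jac (emb z) embF ->
    forall x, emb (br x z) = jac (emb x) (emb z).
  move=> ze zh zf; apply: Pl_ind.
  - by move=> c; rewrite brCl rmorph0 embC jacC.
  - by rewrite brN jacN rmorphN ze emb_e.
  - by rewrite brN jacN rmorphN zh emb_h.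
  - by rewrite brN jacN rmorphN zf emb_f.
  - by move=> a b IHa IHb; rewrite brDl !rmorphD jacDl IHa IHb.
  - by move=> a b IHa IHb; rewrite brMl !(rmorphD, rmorphM) jacMl IHa IHb.
have emb2 : emb 2 = 2 by rewrite rmorph_nat.
have fE z : emb (br z f) = jac (emb z) embF.
  rewrite -emb_f; move: z; apply: gen.
  - by rewrite brN br_ef jacN emb_f jac_EF rmorphN emb_h.
  - by rewrite brN br_hf jacN emb_f jac_HF opprK opprK rmorphM emb2 emb_f.
  - by rewrite brxx rmorph0 emb_f jacxx.
have hE z : emb (br z h) = jac (emb z) embH.
  rewrite -emb_h; move: z; apply: gen => //.
  - by rewrite br_he emb_h jac_HE rmorphM emb2 emb_e.
  - by rewrite brxx rmorph0 emb_h jacxx.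
have eE z : emb (br z e) = jac (emb z) embE.
  rewrite -emb_e; move: z; apply: gen => //.
  by rewrite brxx rmorph0 emb_e jacxx.
exact: gen.
Qed.

Lemma emb_br_f y : emb (br f y) = (emb y)^`().
Proof. by rewrite emb_br emb_f jacFE. Qed.

Lemma two_neq0 : 2 != 0 :> K.
Proof. by rewrite (natf_eq0 charK0 2). Qed.

(** Parametrizes the subalgebra K[e, f]: the outer variable now stands for e, not for the coordinate
    X. *)
Definition eval_ef (a : R) : P := (map_poly (horner_alg f) a).[e].

Lemma emb_eval_ef (a : R) : emb (eval_ef a) = a \Po embE.
Proof.
rewrite /eval_ef; elim/poly_ind: a => [|a c IH].
  by rewrite rmorph0 horner0 rmorph0 comp_poly0.
rewrite rmorphD rmorphM /= map_polyX map_polyC /= hornerMXaddC rmorphD rmorphM.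
by rewrite IH emb_e emb_horner comp_poly_MXaddC.
Qed.

(** Since h^2 = lam - 4ef, the elements 1 and h generate [P_lambda] over K[e, f]. *)
Lemma normal_form y : exists a b : R, y = eval_ef a + h * eval_ef b.
Proof.
have nfD a b : eval_ef (a + b) = eval_ef a + eval_ef b by rewrite /eval_ef
  rmorphD hornerD.
have nfM a b : eval_ef (a * b) = eval_ef a * eval_ef b by rewrite /eval_ef
  rmorphM hornerM.
have nfC (r : {poly K}) : eval_ef r%:P = horner_alg f r.
  by rewrite /eval_ef map_polyC hornerC.
have nf0 : eval_ef 0 = 0 by rewrite /eval_ef rmorph0 horner0.
move: y; apply: Pl_ind.
- by move=> c; exists c%:P%:P, 0; rewrite nfC nf0 mulr0 addr0 horner_algC.
- by exists 'X, 0; rewrite nf0 mulr0 addr0 /eval_ef map_polyX hornerX.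
- by exists 0, 1%:P; rewrite nf0 nfC rmorph1 mulr1 add0r.
- by exists 'X%:P, 0; rewrite nfC nf0 mulr0 addr0 horner_algX.
- move=> x y [a [b ->]] [c [d ->]]; exists (a + c), (b + d).
  by rewrite !nfD; ring.
move=> x y [a [b ->]] [c [d ->]].
exists (a * c + (lam%:P%:P - 4%:P%:P * 'X * 'X%:P) * b * d), (a * d + b * c).
have -> : eval_ef (a * c + (lam%:P%:P - 4%:P%:P * 'X * 'X%:P) * b * d) =
    eval_ef a * eval_ef c + h ^+ 2 * eval_ef b * eval_ef d.
  have -> : h ^+ 2 = eval_ef (lam%:P%:P - 4%:P%:P * 'X * 'X%:P).
    have nfN u : eval_ef (- u) = - eval_ef u by rewrite /eval_ef rmorphN
      hornerN.
    rewrite nfD nfN !nfM !nfC !horner_algC horner_algX -Pl_casimir.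
    have -> : eval_ef 'X = e by rewrite /eval_ef map_polyX hornerX.
    by rewrite scaler_nat addrC; ring.
  by rewrite nfD !nfM.
by rewrite nfD !nfM; ring.
Qed.

Lemma embE_poly : embE = ((- 'X)%:P * 'X + (- q%:P)%:P) * 'X.
Proof. by rewrite /embE /embF !polyCN; ring. Qed.

Lemma size_embE : size embE = 3%N.
Proof.
have X0 : (- 'X : {poly K}) != 0 by rewrite oppr_eq0 polyX_eq0.
have sz : size ((- 'X)%:P * 'X + (- q%:P)%:P : R) = 2%N.
  by rewrite size_MXaddC polyC_eq0 (negPf X0) size_polyC X0.
by rewrite embE_poly size_mulX ?sz // -size_poly_gt0 sz.
Qed.

Lemma lead_coef_embE : lead_coef embE = - 'X.
Proof.
rewrite lead_coefE size_embE embE_poly coefMX /= coefD coefC addr0 coefMX /=.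
by rewrite coefC.
Qed.

Lemma embH_poly : embH = (2 * 'X)%:P * 'X + q%:P%:P.
Proof. by rewrite /embH /embF rmorphM rmorph_nat; ring. Qed.

Lemma twoX_neq0 : 2 * 'X != 0 :> {poly K}.
Proof.
by rewrite mulf_neq0 ?polyX_eq0 // -(polyC_natr _ 2) polyC_eq0 two_neq0.
Qed.

Lemma size_twoX : size (2 * 'X : {poly K}) = 2%N.
Proof. by rewrite -(polyC_natr _ 2) size_Cmul ?two_neq0 // size_polyX. Qed.

Lemma size_embH : size embH = 2%N.
Proof. by rewrite embH_poly size_MXaddC polyC_eq0 (negPf twoX_neq0)
  size_polyC twoX_neq0. Qed.

Lemma lead_coef_embH : lead_coef embH = 2 * 'X.
Proof. by rewrite lead_coefE size_embH embH_poly coefD coefC addr0 coefMX /=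
  coefC. Qed.

Lemma size_comp_embE (a : R) : (size (a \Po embE)).-1 = (size a).-1.*2.
Proof. by rewrite size_comp_poly size_embE muln2. Qed.

Lemma comp_embE_eq0 (a : R) : (a \Po embE == 0) = (a == 0).
Proof. by rewrite comp_poly_eq0 // size_embE. Qed.

Lemma lead_coef_comp_embE (a : R) :
  lead_coef (a \Po embE) = lead_coef a * (- 'X) ^+ (size a).-1.
Proof. by rewrite lead_coef_comp ?size_embE // lead_coef_embE. Qed.

Lemma emb_normal_form (a b : R) :
  emb (eval_ef a + h * eval_ef b) = a \Po embE + embH * (b \Po embE).
Proof. by rewrite rmorphD rmorphM !emb_eval_ef emb_h. Qed.

Lemma size_embH_comp (b : R) : b != 0 ->
  size (embH * (b \Po embE)) = (size b).-1.*2.+2.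
Proof.
move=> b0; have c0 : b \Po embE != 0 by rewrite comp_embE_eq0.
rewrite size_mul -?size_poly_gt0 ?size_embH ?size_poly_gt0 // add2n /=.
by rewrite -size_comp_embE prednK // size_poly_gt0.
Qed.

Lemma size_comp_embE_odd (a : R) : a != 0 ->
  size (a \Po embE) = (size a).-1.*2.+1.
Proof.
by move=> a0; rewrite -size_comp_embE prednK // size_poly_gt0 comp_embE_eq0.
Qed.

(** A nonzero element of K[e, f] has even X-degree, as [embE] has X-degree 2, while [embH] adds 1.
    The two parts of a normal form therefore cannot cancel. *)
Lemma emb_inj : injective emb.
Proof.
apply: raddf_inj => y; have [a [b ->]] := normal_form y => e1.
have e0 : emb (eval_ef a + h * eval_ef b) = 0 := e1;
  rewrite emb_normal_form in e0 => {e1}.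
have nf0 : eval_ef 0 = 0 by rewrite /eval_ef rmorph0 horner0.
have [b0|b0] := eqVneq b 0.
  move: e0; rewrite b0 comp_poly0 mulr0 addr0 => /eqP; rewrite comp_embE_eq0.
  by move/eqP=> ->; rewrite nf0 mulr0 addr0.
move/eqP: e0; rewrite addr_eq0 => /eqP/(congr1 (fun p : R => size p)).
rewrite size_polyN size_embH_comp //.
have [->|a0] := eqVneq a 0; first by rewrite comp_poly0 size_poly0.
by rewrite size_comp_embE_odd // => -[] /(congr1 odd); rewrite /= !odd_double.
Qed.

Lemma size_mul_Xn (r : {poly K}) n : r != 0 -> size (r * (- 'X) ^+ n) = (size r
  + n)%N.
Proof.
move=> r0; rewrite exprNn mulrCA size_Msign size_mulXn //; exact: addnC.
Qed.

(* The two terms of the normal form have X-degrees of opposite parity. *)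
Lemma lead_coef_emb y : emb y != 0 ->
  ((size (emb y)).-1 <= (size (lead_coef (emb y))).-1.*2)%N.
Proof.
have [a [b ->]] := normal_form y; rewrite emb_normal_form.
set A := a \Po embE; set B := embH * (b \Po embE) => nz.
(* The even part has X-degree 2 deg a and leading coefficient lc(a) (-f)^(deg a), of f-degree at
   least deg a. The odd part gains one X and one f from the leading term of [embH]. *)
have caseA : a != 0 -> (size B < size A)%N ->
  ((size (A + B)%R).-1 <= (size (lead_coef (A + B)%R)).-1.*2)%N.
  move=> a0 lt; rewrite size_polyDl // lead_coefDl // /A lead_coef_comp_embE.
  rewrite size_comp_embE leq_double size_mul_Xn ?lead_coef_eq0 //.
  have : (0 < size (lead_coef a))%N by rewrite size_poly_gt0 lead_coef_eq0.
  by case: (size (lead_coef a)) => // m _; rewrite addSn /= leq_addl.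
have caseB : b != 0 -> (size A < size B)%N ->
  ((size (A + B)%R).-1 <= (size (lead_coef (A + B)%R)).-1.*2)%N.
  move=> b0 lt; rewrite addrC size_polyDl // lead_coefDl // /B size_embH_comp
    //=.
  rewrite lead_coefM lead_coef_embH lead_coef_comp_embE mulrA size_mul_Xn;
    last first.
    by rewrite mulf_neq0 ?twoX_neq0 // lead_coef_eq0.
  have lb : (0 < size (lead_coef b))%N by rewrite size_poly_gt0 lead_coef_eq0.
  rewrite size_mul ?twoX_neq0 ?lead_coef_eq0 // size_twoX.
  by case: (size (lead_coef b)) lb => // m _; rewrite -!muln2;
    move: (size b).-1 => k; lia.
have [b0|b0] := eqVneq b 0.
  move: nz caseA; rewrite /A /B b0 comp_poly0 mulr0 addr0 comp_embE_eq0 => a0.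
  by apply=> //; rewrite size_poly0 size_poly_gt0 comp_embE_eq0.
have [a0|a0] := eqVneq a 0.
  by apply: caseB => //; rewrite /A /B a0 comp_poly0 size_poly0 size_embH_comp.
have [lt|gt|eq] := ltngtP (size A) (size B).
- exact: caseB.
- exact: caseA.
- move: eq; rewrite /A /B size_embH_comp // size_comp_embE_odd // => -[].
  by move/(congr1 odd); rewrite /= !odd_double.
Qed.

End Embedding.

(** * Automorphisms mapping f into K[f] *)

Section Triangular.
Variables (K : fieldType) (lam q : K).
Hypothesis charK0 : [pchar K] =i pred0.
Local Notation P := (P_lambda lam).
Local Notation R := {poly {poly K}}.
Local Notation e := (Pl_e lam).
Local Notation h := (Pl_h lam).
Local Notation f := (Pl_f lam).
Local Notation br := (@Pl_bracket K lam).
Variable emb : {rmorphism P -> R}.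
Hypothesis embP : is_embedding q emb.
Implicit Types s t : poisson_aut br.

Lemma paut_gen_ext s t : s e = t e -> s h = t h -> s f = t f -> s = t.
Proof.
move=> se sh sf; apply: paut_ext.
apply: (Pl_hom_ext (F := s) (G := t)) => // c.
by rewrite /= !paut_algC.
Qed.

Lemma paut_horner s x r : s (horner_alg x r) = horner_alg (s x) r.
Proof.
elim/poly_ind: r => [|r c IH]; first by rewrite !rmorph0.
by rewrite !rmorphD !rmorphM /= !horner_algX !horner_algC IH paut_algC.
Qed.

Lemma emb_horner_comp x r p : emb x = r%:P -> emb (horner_alg x p) =
  (p \Po r)%:P.
Proof.
move=> xr; elim/poly_ind: p => [|p c IH]; first by rewrite comp_poly0 !rmorph0.
rewrite comp_poly_MXaddC !(rmorphD, rmorphM) /= horner_algX horner_algC.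
by rewrite IH xr (embC embP).
Qed.

Lemma deriv_poly_eq0 (p : R) : p^`() = 0 -> p = (p`_0)%:P.
Proof.
move=> p0; apply/polyP => -[|i]; rewrite coefC //=.
apply/polyP => j; apply/eqP; rewrite coef0.
have /(congr1 (fun u : R => u`_i`_j)) := p0.
rewrite coef_deriv coefMn !coef0 -mulr_natl => /eqP.
by rewrite mulf_eq0 (natf_eq0 charK0).
Qed.

(** {f, .} is d/dX, whose kernel in characteristic 0 is K[f]. *)
Lemma br_f_eq0 y : br f y = 0 -> exists k, y = horner_alg f k.
Proof.
move=> y0; have := emb_br_f embP y; rewrite y0 rmorph0 => /esym.
move/deriv_poly_eq0 => yk; exists (emb y)`_0.
by apply: (emb_inj charK0 embP); rewrite (emb_horner embP).
Qed.

(* X itself is not in the image of P_lambda, even modulo K[f]. *)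
Lemma emb_affine_X y (k : K) (r : {poly K}) : emb y = k%:P *: 'X + r%:P -> k =
  0.
Proof.
move=> yE; apply/eqP/negbNE/negP => k0.
have kP : k%:P != 0 :> {poly K} by rewrite polyC_eq0.
have sz : size (k%:P *: 'X + r%:P : R) = 2%N.
  by rewrite -mul_polyC size_MXaddC polyC_eq0 (negPf kP) size_polyC kP.
have := lead_coef_emb charK0 embP (y := y); rewrite yE.
rewrite -size_poly_gt0 sz => /(_ isT).
rewrite lead_coefE sz coefD coefZ coefX coefC mulr1 addr0.
by rewrite size_polyC k0.
Qed.

(** The centralizer of f forces s f to be affine in f. The bracket of s h with s f then fixes s h
    modulo K[f], and the Casimir relation fixes the rest, including s e. *)
Lemma triangular_form s r : emb (s f) = r%:P -> exists g nu D H,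
  [/\ nu != 0, is_Delta g D, is_Hrot nu H & s = (D * H)%g].
Proof.
move=> sfr.
(* K[f] is the centralizer of f, and f commutes with s f. *)
have size_r : size r = 2%N.
  have c0 : br (s f) f = 0.
    apply: (emb_inj charK0 embP); rewrite (emb_br embP) sfr (emb_f embP).
    by rewrite rmorph0 /jac !dZC !derivC mulr0 mul0r subrr.
  have [k kE] : exists k, (s^-1)%g f = horner_alg f k.
    apply: br_f_eq0; apply: (@paut_inj _ _ _ s).
    by rewrite paut_br pautKV c0 rmorph0.
  have := congr1 emb (pautKV s f); rewrite kE paut_horner.
  rewrite (emb_horner_comp _ sfr) (emb_f embP) /embF => /polyC_inj.
  move/(congr1 (fun p : {poly K} => (size p).-1));
    rewrite size_comp_poly size_polyX /=.
  by move/eqP; rewrite muln_eq1 => /andP[_]; case: (size r) => [|[|[|]]].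
pose al := r`_1; pose s0 := r`_0.
have rE : r = al *: 'X + s0%:P.
  apply/polyP => -[|[|i]]; rewrite coefD coefZ coefX coefC /=
    ?mulr0 ?mulr1 ?add0r ?addr0 //.
  by rewrite nth_default // size_r.
have al0 : al != 0 by have := lead_coef_eq0 r;
  rewrite lead_coefE size_r /= -size_poly_eq0 size_r => ->.
have two0 := two_neq0 charK0.
(* {s h, s f} = -2 s f reads al d(s h)/dX = 2 (al f + s0), while dh/dX = 2f. The term linear in X
   must vanish by [emb_affine_X], whence s0 = 0. *)
have shD : emb (s h - h) = (2 * s0 / al)%:P *: 'X + ((emb (s h - h) -
  (2 * s0 / al)%:P *: 'X)`_0)%:P.
  rewrite -[LHS](subrK ((2 * s0 / al)%:P *: 'X)) [LHS]addrC; congr (_ + _).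
  apply: deriv_poly_eq0.
  have alP : al%:P%:P != 0 :> R by rewrite !polyC_eq0.
  apply: (mulfI alP); rewrite mulr0 derivB derivZ derivX rmorphB derivB /=
    (emb_h embP).
  have : emb (br (s h) (s f)) = - (2 * emb (s f)).
    by rewrite -paut_br br_hf rmorphN rmorphM rmorph_nat rmorphN rmorphM
      rmorph_nat.
  rewrite (emb_br embP) sfr /jac dZC !derivC mulr0 sub0r => /oppr_inj.
  rewrite rE derivD derivZ derivX derivC addr0 alg_polyC => bE.
  rewrite mulrBr mulrBr mulrC bE /embH derivD derivC add0r.
  have -> : (2 * s0 / al)%:P *: (1 : R) = (2 * s0 / al)%:P%:P by rewrite
    alg_polyC.
  rewrite derivM derivX mulr1 derivM /embF derivC -(polyC_natr _ 2) derivC.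
  rewrite !mul0r mulr0 addr0 mul0r add0r.
  have kE : al%:P%:P * (2 * s0 / al)%:P%:P = 2 * s0%:P%:P :> R.
    by rewrite -!polyCM [al * _]mulrC divfK // !mulr_natl !polyCMn.
  by rewrite kE -mul_polyC !polyCD !polyCM !polyC1; ring.
have s00 : s0 = 0.
  have /eqP := emb_affine_X shD; rewrite !mulf_eq0 invr_eq0 (negPf al0)
    (negPf two0).
  by rewrite orbF => /eqP.
move: shD; rewrite s00 mulr0 mul0r polyC0 scale0r add0r subr0.
set be := _`_0 => shD.
have sfE : s f = al *: f.
  apply: (emb_inj charK0 embP); rewrite sfr rE s00 (embZ embP) (emb_f embP).
  by rewrite polyC0 addr0 -mul_polyC polyCM.
have shE : emb (s h) = embH q + be%:P.
  by rewrite -(emb_h embP) -shD -rmorphD addrC subrK.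
have cas t : 4 * emb (t e) * emb (t f) + emb (t h) ^+ 2 =
    4 * embE q * embF K + embH q ^+ 2.
  rewrite -(emb_e embP) -(emb_f embP) -(emb_h embP).
  have c x y z : emb (4 * x * y + z ^+ 2) = 4 * emb x * emb y + emb z ^+ 2.
    by rewrite rmorphD !rmorphM rmorph_nat.
  rewrite -!c; congr (emb _).
  by rewrite Pl_casimir -(paut_algC t) -Pl_casimir rmorphD !rmorphM rmorph_nat.
have sfE' : emb (s f) = al%:P%:P * embF K.
  by rewrite sfE (embZ embP) (emb_f embP).
have casE := cas s; rewrite sfE' shE in casE.
have F0 : embF K != 0 by rewrite polyC_eq0 polyX_eq0.
have [b1 [b0 beE]] : exists b1 b0, be = b1 * 'X + b0%:P.
  by elim/poly_ind: (be) => [|p c _]; [exists 0, 0;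
    rewrite mul0r addr0|exists p, c].
(* The Casimir relation leaves b0 = 0 or b0 = - 2q, the latter being a
   symmetry h |-> h - 2q of K[X, f] that does not preserve P_lambda. *)
have b00 : b0 = 0.
  apply/eqP/negbNE/negP => b0n.
  have b0E : b0 = - (2 * q).
    (* At X = f = 0 the Casimir relation becomes (q + b0)^2 = q^2. *)
    pose ev : {rmorphism R -> K} := horner_eval 0 \o horner_eval 0.
    have evF : ev (embF K) = 0 by rewrite /ev /= /horner_eval hornerC hornerX.
    have evE : ev (embE q) = 0.
      by rewrite /embE rmorphN rmorphM /ev /= /horner_eval hornerX horner0
        mul0r oppr0.
    have evH : ev (embH q) = q.
      by rewrite /embH rmorphD rmorphM rmorphM evF mulr0 mul0r addr0 /ev /=
        /horner_eval !hornerC.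
    have evb : ev be%:P = b0.
      by rewrite beE /ev /= /horner_eval !hornerE.
    have evc x y z : ev (4 * x * y + z ^+ 2) = 4 * ev x * ev y + ev z ^+ 2.
      by rewrite rmorphD !rmorphM rmorph_nat.
    have evM x y : ev (x * y) = ev x * ev y by rewrite rmorphM.
    have := congr1 ev casE; rewrite !evc evM evF evE !mulr0 !add0r.
    rewrite rmorphD evH evb => qb.
    have /eqP : b0 * (2 * q + b0) = 0.
      by apply: (addIr (q ^+ 2)); rewrite add0r -[RHS]qb; ring.
    rewrite mulf_eq0 (negPf b0n) /= => /eqP ?; apply/eqP.
    by rewrite -addr_eq0 addrC; apply/eqP.
  have eqn : 4 * (al%:P%:P * emb (s e) - embE q) = - (be%:P * (4 * 'X + b1%:P)).
    apply: (mulfI F0).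
    have -> : embF K * (4 * (al%:P%:P * emb (s e) - embE q)) =
       embH q ^+ 2 - (embH q + be%:P) ^+ 2.
      have -> : embF K * (4 * (al%:P%:P * emb (s e) - embE q)) =
       4 * emb (s e) * (al%:P%:P * embF K) + (embH q + be%:P) ^+ 2
       - 4 * embE q * embF K - (embH q + be%:P) ^+ 2 by ring.
      by rewrite casE; ring.
    rewrite beE polyCD polyCM -/(embF K) b0E /embH !(polyCN, polyCM, polyCD,
      polyC1).
    by ring.
  (* Adding 2 b1(f) h cancels the term in fX and leaves -4 b0 X modulo K[f], which [emb_affine_X]
     forbids for nonzero b0. *)
  have : emb (4 * (al *: s e - e) + 2 * horner_alg f b1 * h) =
      (- (4 * b0))%:P *: 'X + (2 * q *: b1 - be * b1)%:P.
    rewrite rmorphD !rmorphM rmorphB !rmorph_nat (embZ embP) (emb_e embP)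
      (emb_h embP).
    rewrite (emb_horner embP) eqn -!mul_polyC beE /embH /embF.
    by rewrite !(rmorphB, rmorphD, rmorphM, rmorphN) /= !polyC1; ring.
  move/emb_affine_X => /eqP; rewrite oppr_eq0 mulf_eq0 (negPf b0n) orbF.
  by rewrite (natf_eq0 charK0 4).
(* Delta_g adds 2 f g(f) to h, and the increment to be matched is f b1(f). *)
pose g := 2^-1 *: b1.
have shg : s h = h + 2 * f * horner_alg f g.
  apply: (emb_inj charK0 embP); rewrite shE rmorphD !rmorphM rmorph_nat.
  rewrite (emb_h embP) (emb_f embP) (emb_horner embP) beE b00; congr (_ + _).
  have -> : b1 = 2 * g.
    by rewrite /g -scalerAr mulr_natl -scaler_nat scalerA mulVf // scale1r.
  by rewrite addr0 -mulrA mulrCA polyCM [in LHS]mulrC !polyCM polyC_natr; ring.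
have [D DP] := Delta_ex lam g.
have al'0 : al^-1 != 0 by rewrite invr_eq0.
have [H HP] := Hrot_ex lam al'0.
exists g, al^-1, D, H; split=> //.
have [De Dh Df] := DP; have [He Hh Hf] := HP.
have DHf : (D * H)%g f = s f by rewrite paut_mulE Hf linearZ /= Df invrK sfE.
have DHh : (D * H)%g h = s h by rewrite paut_mulE Hh Dh shg.
apply: paut_gen_ext => //; apply: (emb_inj charK0 embP).
(* The Casimir relation determines s e from s h and s f, because the image of s f is nonzero in a
   domain. *)
have := cas (D * H)%g; rewrite -(cas s) DHf DHh => /addIr.
rewrite -!mulrA => /(mulfI _) E; symmetry.
have n4 : 4 != 0 :> R.
  by rewrite -(polyC_natr {poly K} 4) polyC_eq0 -(polyC_natr K 4) polyC_eq0
    (natf_eq0 charK0).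
have sf0 : emb (s f) != 0 by rewrite sfE' mulf_neq0 // !polyC_eq0.
exact: (mulIf sf0 (E n4)).
Qed.

End Triangular.

(** * The action of Delta_g and of omega in the coordinates X, f *)

(** The rational identities behind X |-> -1/X, f |-> qX + fX^2, isolated over an abstract field. *)
Lemma swap_e_aux (L : fieldType) (a b x : L) : x != 0 ->
  - (- x^-1 * (a + x * (a + b * x) * (- x^-1))) = - b.
Proof. by move=> x0; field. Qed.

Lemma swap_h_aux (L : fieldType) (a b x : L) : x != 0 ->
  a + (1 + 1) * (x * (a + b * x)) * (- x^-1) = - (a + (1 + 1) * b * x).
Proof. by move=> x0; field. Qed.

Lemma swap_term_aux (L : fieldType) (a b c d : L) : b != 0 ->
  a * b * (d * (c * b^-1)) = c * a * d.
Proof. by move=> b0; field. Qed.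

Section Swap.
Variables (K : fieldType) (lam q : K).
Local Notation P := (P_lambda lam).
Local Notation R := {poly {poly K}}.
Local Notation e := (Pl_e lam).
Local Notation h := (Pl_h lam).
Local Notation f := (Pl_f lam).
Local Notation br := (@Pl_bracket K lam).
Variable emb : {rmorphism P -> R}.
Hypothesis embP : is_embedding q emb.
Implicit Types s t : poisson_aut br.

Lemma emb_Delta g s y : is_Delta g s -> emb (s y) = emb y \Po ('X + g%:P).
Proof.
move=> [se sh sf]; move: y.
pose F : {rmorphism P -> R} := emb \o s.
pose G : {rmorphism P -> R} := comp_poly ('X + g%:P) \o emb.
have FE y : F y = emb (s y) by [].
have GE y : G y = emb y \Po ('X + g%:P) by [].
suff FG : F =1 G by move=> y; rewrite -FE FG.
have cE (a b : R) : (a * b) \Po ('X + g%:P) = (a \Po ('X + g%:P)) * (b \Po ('X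
  + g%:P)) by rewrite comp_polyM.
apply: Pl_hom_ext => [c|||]; rewrite FE GE.
- by rewrite paut_algC (embC embP) comp_polyC.
- rewrite se !rmorphB !rmorphM !(emb_horner embP) (emb_e embP) (emb_h embP)
  (emb_f embP).
  rewrite /embE /embH /embF rmorphN /= -expr2 cE comp_polyD cE comp_polyX
    !comp_polyC.
  by ring.
- rewrite sh (emb_h embP) /embH /embF rmorphD !rmorphM rmorph_nat
  (emb_horner embP).
  rewrite (emb_h embP) (emb_f embP) comp_polyD !cE comp_polyX !comp_polyC /embH
    /embF.
  rewrite -[2](polyC_natr {poly K} 2) comp_polyC; ring.
- by rewrite sf (emb_f embP) comp_polyC.
Qed.

Definition is_omega s : Prop := [/\ s e = - f, s h = - h & s f = - e].

Lemma omega_ex : exists s, is_omega s.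
Proof.
have br0 x : br x 0 = 0 by have := brCr 0 x; rewrite scale0r.
have brNr x y : br x (- y) = - br x y.
  by apply/eqP; rewrite -addr_eq0 -brDr addNr br0.
have brNl x y : br (- x) y = - br x y by rewrite brN brNr -brN.
have rel : sl2_relations br lam (triple (- f) (- h) (- e)).
  rewrite /sl2_relations /triple /=; split.
  - by rewrite brNr brNl opprK brN br_ef.
  - by rewrite brNr brNl opprK br_hf mulrN.
  - by rewrite brNr brNl opprK br_he mulrN opprK.
  - by rewrite -Pl_casimir; ring.
have [F FP Fv] := Pl_endo rel; have [lF F1 FM FB] := FP.
have FN x : F (- x) = - F x.
  have F0 : F 0 = 0 by have := lF (-1) 0 0;
    rewrite scaler0 addr0 scaleN1r addNr.
  by rewrite -[- x]addr0 -scaleN1r lF F0 addr0 scaleN1r.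
have Fe : F e = - f by rewrite [LHS]Fv.
have Fh : F h = - h by rewrite [LHS]Fv.
have Ff : F f = - e by rewrite [LHS]Fv.
have FF i : F (F (Pl_gen lam i)) = Pl_gen lam i.
  move: i; apply: I3_ind.
  - by rewrite Fe FN Ff opprK.
  - by rewrite Fh FN Fh opprK.
  - by rewrite Ff FN Fe opprK.
have FA : is_poisson_aut br F by apply: (poisson_endo_aut FP FP).
by exists (mk_paut FA).
Qed.

(* The identity emb (s y) = (emb y)(-1/X, qX + fX^2),
  cleared of denominators. *)
Lemma Laurent_swap s y : is_omega s ->
  let g : {rmorphism {poly K} -> R} :=
    horner_eval (q%:P%:P * 'X + embF K * 'X ^+ 2) \o map_poly (polyC \o polyC)
      in
  'X ^+ size (emb y) * emb (s y) =
  \sum_(u < size (emb y)) (-1) ^+ u * 'X ^+ (size (emb y) - u) * g (emb y)`_u.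
Proof.
move=> [se sh sf] g; pose L := {fraction R}.
pose T : {rmorphism R -> L} := @tofrac R.
pose x0 : L := - (T 'X)^-1.
(* [psi] is this substitution with values in the fraction field, and [g] is its restriction to K[f].
   Both morphisms out of [P_lambda] are compared on e, h, f. *)
pose psi : {rmorphism R -> L} := horner_eval x0 \o map_poly (T \o g).
have X0 : T 'X != 0 by rewrite tofrac_eq0 polyX_eq0.
have psiX : psi 'X = x0 by rewrite /psi /= map_polyX /horner_eval hornerX.
have psiC r : psi r%:P = T (g r) by rewrite /psi /=
  map_polyC /horner_eval hornerC.
have gC c : g c%:P = c%:P%:P by rewrite /g /= map_polyC /horner_eval hornerC.
have gX : g 'X = q%:P%:P * 'X + embF K * 'X ^+ 2.
  by rewrite /g /= map_polyX /horner_eval hornerX.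
pose F : {rmorphism P -> L} := psi \o emb.
pose H : {rmorphism P -> L} := T \o (emb \o s).
have FH : F =1 H.
  have FE z : F z = psi (emb z) by [].
  have HE z : H z = T (emb (s z)) by [].
  have psiF : psi (embF K) = T 'X * (T q%:P%:P + T (embF K) * T 'X).
    by rewrite psiC gX rmorphD !rmorphM /=; ring.
  have psiq : psi q%:P%:P = T q%:P%:P by rewrite psiC gC.
  apply: Pl_hom_ext => [c|||]; rewrite FE HE.
  - by rewrite paut_algC (embC embP) psiC gC.
  - rewrite se rmorphN (emb_e embP) (emb_f embP) /embE !rmorphN !(rmorphM,
    rmorphD).
    rewrite psiX psiF psiq /x0. exact: swap_e_aux.
  - rewrite sh rmorphN (emb_h embP) /embH rmorphN !(rmorphM,
    rmorphD) psiX psiF psiq.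
    rewrite !rmorph1 /x0. exact: swap_h_aux.
  - by rewrite sf rmorphN (emb_e embP) (emb_f embP)
    psiF /embE opprK rmorphM rmorphD rmorphM.
apply/eqP; rewrite -tofrac_eq -![tofrac _]/(T _); apply/eqP.
have -> : T ('X ^+ size (emb y) * emb (s y)) = T 'X ^+ size (emb y) * psi
  (emb y).
  by rewrite rmorphM rmorphXn -[T (emb _)]/(H y) -FH.
have -> : psi (emb y) = \sum_(u < size (emb y)) T (g (emb y)`_u) * x0 ^+ u.
  rewrite -{1}[emb y]coefK poly_def rmorph_sum.
  by apply: eq_bigr => i _; rewrite -mul_polyC rmorphM rmorphXn psiX psiC.
rewrite !rmorph_sum mulr_sumr; apply: eq_bigr => i _.
rewrite !rmorphM !rmorphXn rmorphN rmorph1 /x0.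
have le : (i <= size (emb y))%N by apply: ltnW.
rewrite -{1}(subnK le) exprD exprNn exprVn.
have : T 'X ^+ i != 0 by rewrite expf_neq0.
exact: swap_term_aux.
Qed.

(** The monomial X^u f^v becomes X^(-u) (qX + fX^2)^v up to sign, of X-degree at most 2v - u. *)
Lemma size_emb_swap s y n : is_omega s ->
  (forall u, (emb y)`_u != 0 -> ((size ((emb y)`_u)%R).-1.*2 < n + u)%N) ->
  (size (emb (s y)) <= n)%N.
Proof.
move=> so deg.
have [->|nz] := eqVneq (emb (s y)) 0; first by rewrite size_poly0.
rewrite -(leq_add2l (size (emb y))) -size_mulXn // mulrC (Laurent_swap y so).
set g := horner_eval _ \o _.
apply: (leq_trans (size_sum _ _ _)); apply/bigmax_leqP => u _.
have [->|cu] := eqVneq (emb y)`_u 0; first by rewrite rmorph0 mulr0 size_poly0.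
rewrite -mulrA size_Msign [_ * g _]mulrC.
apply: leq_trans (size_polyMleq _ _) _.
rewrite size_polyXn addnS /=.
have sg r : (size (g r) <= (size r).-1.*2.+1)%N.
  rewrite /g /= /horner_eval horner_coef size_map_poly.
  apply: (leq_trans (size_sum _ _ _)); apply/bigmax_leqP => i _.
  rewrite coef_map /=; apply: leq_trans (size_polyMleq _ _) _.
  have le1 : (size (r`_i)%:P%:P <= 1)%N by exact: size_polyC_leq1.
  set z := _ + _; have sz : (size z <= 3)%N.
    rewrite /z; apply: leq_trans (size_polyD _ _) _; rewrite geq_max.
    by rewrite !(leq_trans (size_polyMleq _ _))
      // size_polyC ?size_polyX ?size_polyXn; case: eqP.
  have := size_poly_exp_leq z i; have := ltn_ord i.
  have : ((size z).-1 * i <= 2 * i)%N by rewrite leq_mul2r;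
    case: (size z) sz => [|[|[|[|]]]] //=; rewrite orbT.
  move: le1; move: (i : nat) => k; rewrite -muln2.
  move: (size _) (_ * k)%N (size _) (size r) => a b c d; lia.
apply: leq_trans (leq_add (sg _) (leqnn _)) _.
have := deg _ cu; have := ltn_ord u.
move: (u : nat) => v; move: (size _).-1.*2 (size (emb y)) => a b; lia.
Qed.
End Swap.

(** * The edges of the Newton polygon *)

Section Puiseux.
Variables (K : fieldType).
Hypothesis charK0 : [pchar K] =i pred0.
Local Notation R := {poly {poly K}}.

Lemma coef_XaddC_exp (S : comNzRingType) (a : S) u j :
  (('X + a%:P) ^+ u)`_j = a ^+ (u - j) *+ 'C(u, j).
Proof.
rewrite addrC exprDn.
have -> : \sum_(i < u.+1) (a%:P ^+ (u - i) * 'X ^+ i) *+ 'C(u, i) =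
    \poly_(i < u.+1) (a ^+ (u - i) *+ 'C(u, i)).
  rewrite poly_def; apply: eq_bigr => i _.
  by rewrite -mul_polyC polyCMn polyC_exp mulrnAl.
rewrite coef_poly ltnS; case: leqP => // lt.
by rewrite bin_small // mulr0n.
Qed.

Lemma coef_comp_XaddC (S : comNzRingType) (p : {poly S}) (a : S) n j :
  (size p <= n)%N ->
  (p \Po ('X + a%:P))`_j = \sum_(u < n) p`_u * (a ^+ (u - j) *+ 'C(u, j)).
Proof.
move=> le; rewrite comp_polyE coef_sum (big_ord_widen n (fun u => (p`_u *: ('X
  + a%:P) ^+ u)`_j)) //.
rewrite big_mkcond; apply: eq_bigr => u _.
case: ltnP => [_|ge]; first by rewrite coefZ coef_XaddC_exp.
by rewrite nth_default // mul0r.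
Qed.

Local Notation powX B := (@comp_poly K 'X^B).

Definition puiseux (A B : nat) (xi : K) (p : R) : R :=
  map_poly (powX B) p \Po ('X + (xi *: 'X^A)%:P).

Lemma dZ_comp (p r : R) : dZ (p \Po r) = (dZ p \Po r) + (p^`() \Po r) * dZ r.
Proof.
elim/poly_ind: p => [|p c IH].
  have dZ0 : dZ 0 = 0 :> R by rewrite -[0 in LHS]polyC0 dZC deriv0 polyC0.
  by rewrite comp_poly0 dZ0 deriv0 !comp_poly0 mul0r addr0.
rewrite comp_poly_MXaddC dZD dZM IH dZC dZD dZM dZX mulr0 addr0 dZC.
rewrite derivMXaddC !comp_polyD !comp_polyM comp_polyX comp_polyC; ring.
Qed.

Lemma dZ_map_comp (p : R) B :
  dZ (map_poly (powX B) p) =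
  (B%:R *: 'X^(B.-1))%:P * map_poly (powX B) (dZ p).
Proof.
apply/polyP => i; rewrite coef_dZ coefCM !coef_map /= deriv_comp derivXn.
by rewrite mulrC -scaler_nat.
Qed.

Lemma deriv_map_comp (p : R) B :
  (map_poly (powX B) p)^`() = map_poly (powX B) p^`().
Proof.
by apply/polyP => i; rewrite coef_deriv !coef_map /= coef_deriv rmorphMn.
Qed.

(** Chain rule: the substitution has Jacobian determinant B Z^(B-1), the shift of X by a function of
    Z contributing nothing. *)
Lemma jac_puiseux A B xi (a b : R) :
  jac (puiseux A B xi a) (puiseux A B xi b) =
  (B%:R *: 'X^(B.-1))%:P * puiseux A B xi (jac a b).
Proof.
have dP p : dZ (puiseux A B xi p) =
    (B%:R *: 'X^(B.-1))%:P * puiseux A B xi (dZ p)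
    + puiseux A B xi p^`() * ((xi *: 'X^A)^`())%:P.
  rewrite /puiseux dZ_comp dZ_map_comp deriv_map_comp comp_polyM comp_polyC.
  by rewrite dZD dZX dZC add0r.
have dX p : (puiseux A B xi p)^`() = puiseux A B xi p^`().
  by rewrite /puiseux deriv_comp deriv_map_comp derivD derivX derivC addr0
    mulr1.
have PM p r : puiseux A B xi (p * r) = puiseux A B xi p * puiseux A B xi r.
  by rewrite /puiseux rmorphM comp_polyM.
have PB p r : puiseux A B xi (p - r) = puiseux A B xi p - puiseux A B xi r.
  by rewrite /puiseux rmorphB comp_polyB.
rewrite /jac !dX !dP PB !PM; ring.
Qed.

Lemma puiseux0 A B xi : puiseux A B xi 0 = 0.
Proof. by rewrite /puiseux rmorph0 comp_poly0. Qed.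

Lemma puiseux_coef A B xi (p : R) n j v : (size p <= n)%N ->
  (puiseux A B xi p)`_j`_v = \sum_(u < n)
    (if (v < A * (u - j))%N then 0 else (p`_u \Po 'X^B)`_(v - A * (u - j)))
    * (xi ^+ (u - j) *+ 'C(u, j)).
Proof.
move=> le; rewrite /puiseux (coef_comp_XaddC _ _ (n := n)); last first.
  by apply: leq_trans (size_poly _ _) le.
rewrite coef_sum; apply: eq_bigr => u _; rewrite coef_map /=.
rewrite exprZn -exprM scalerMnl -scalerAr coefZ mulrC; congr (_ * _).
by rewrite coefMXn.
Qed.

Variables (p : R) (N A B W : nat) (xi : K).
Hypotheses (size_p : (size p <= N.+1)%N) (AN : (A * N <= W)%N).
Hypothesis W_max : forall u v, (u <= N)%N -> (p`_u \Po 'X^B)`_v != 0 ->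
  (A * u + v <= W)%N.

(** The coefficients of p along the line A u + v = W, read as a polynomial in X alone; A N <= W
    keeps the subtraction exact. *)
Definition edge_poly : {poly K} :=
  \poly_(u < N.+1) (p`_u \Po 'X^B)`_(W - A * u).

(** X |-> X + xi Z^A is homogeneous when X has weight A and Z weight 1, so no monomial rises above
    the line. *)
Lemma puiseux_le j v : (puiseux A B xi p)`_j`_v != 0 -> (A * j + v <= W)%N.
Proof.
apply: contraNT => lt; rewrite (puiseux_coef _ _ _ _ _ size_p) big1 // => u _.
have [uj|ju] := ltnP u j; first by rewrite bin_small // mulr0n mulr0.
case: ltnP => [_|le]; first by rewrite mul0r.
have [->|nz] := eqVneq (p`_u \Po 'X^B)`_(v - A * (u - j)) 0;
  first by rewrite mul0r.
have uN : (u <= N)%N by rewrite -ltnS.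
have := W_max uN nz; rewrite mulnBr in le *.
have : (A * j <= A * u)%N by rewrite leq_mul2l ju orbT.
move: (A * j)%N (A * u)%N le lt => x y; lia.
Qed.

(** By the same homogeneity, the substitution acts on the line itself as the translation X |-> X +
    xi. *)
Lemma puiseux_edge j : (j <= N)%N ->
  (puiseux A B xi p)`_j`_(W - A * j) = (edge_poly \Po ('X + xi%:P))`_j.
Proof.
move=> jN; rewrite (puiseux_coef _ _ _ _ _ size_p) (coef_comp_XaddC _ _
  (size_poly _ _)).
apply: eq_bigr => u _; have [uj|ju] := ltnP u j.
  by rewrite bin_small // !mulr0n !mulr0.
congr (_ * _); have uN : (u <= N)%N by rewrite -ltnS.
have e1 : (A * j <= A * u)%N by rewrite leq_mul2l ju orbT.
have e2 : (A * u <= W)%N by apply: leq_trans AN; rewrite leq_mul2l uN orbT.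
rewrite mulnBr coef_poly ltn_ord ltnNge.
have -> : (A * u - A * j <= W - A * j)%N by apply: leq_sub2r.
congr (_`_ _); lia.
Qed.

(* These weights refine A j + v by preferring small powers of X. *)
Lemma puiseux_leading m r : edge_poly = r * ('X - xi%:P) ^+ m ->
  ~~ root r xi -> (m <= N)%N ->
  leading (N.+1%:Z * A%:Z - 1) N.+1%:Z (puiseux A B xi p) m (W - A * m).
Proof.
move=> eE rxi mN.
(* After translation by the root, the edge polynomial is X^m times a polynomial with nonzero
   constant term, so X^m is its lowest term. *)
have ce j : (edge_poly \Po ('X + xi%:P))`_j =
    if (j < m)%N then 0 else (r \Po ('X + xi%:P))`_(j - m).
  have XE : 'X + xi%:P - (xi%:P \Po ('X + xi%:P)) =
    'X by rewrite comp_polyC addrK.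
  rewrite eE comp_polyM [('X - _) ^+ m \Po _]rmorphXn /=
    comp_polyB comp_polyX XE.
  by rewrite coefMXn.
have AmW : (A * m <= W)%N by apply: leq_trans AN; rewrite leq_mul2l mN orbT.
split.
  by rewrite puiseux_edge // ce ltnn subnn -horner_coef0 horner_comp hornerD
    hornerX hornerC add0r.
have wtE j v : wt (N.+1%:Z * A%:Z - 1) N.+1%:Z j v =
    (N.+1 * (A * j + v))%N%:Z - j%:Z.
  by rewrite /wt PoszM PoszD PoszM; ring.
move=> j v nz ne; have le := puiseux_le nz; rewrite !wtE subnKC //.
(* A drop of 1 in A j + v costs N + 1, more than the at most m <= N that a smaller power of X can
   gain. *)
have [lt|ge] := ltnP (A * j + v) W.
  have : (N.+1 * (A * j + v).+1 <= N.+1 * W)%N by rewrite leq_mul2l lt orbT.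
  rewrite mulnS; move: (_ * _)%N (_ * W)%N => x y; lia.
have vE : v = (W - A * j)%N by lia.
have jN : (j <= N)%N.
  rewrite leqNgt; apply/negP => Nj; case/eqP: nz.
  rewrite (puiseux_coef _ _ _ _ _ size_p) big1 // => u _.
  by rewrite bin_small ?mulr0n ?mulr0 //; apply: leq_trans (ltn_ord u) Nj.
move: nz; rewrite vE puiseux_edge // ce; case: ltnP; rewrite ?eqxx // => mj _.
have neq : j <> m by move=> e; apply: ne; rewrite vE e.
have AjW : (A * j <= W)%N by apply: leq_trans AN; rewrite leq_mul2l jN orbT.
rewrite subnKC //; lia.
Qed.

End Puiseux.

(** * Local nilpotency of {s f, .} and bounds on leading monomials *)

Section Nilpotent.
Variables (K : fieldType) (lam q : K).
Hypothesis charK0 : [pchar K] =i pred0.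
Local Notation P := (P_lambda lam).
Local Notation R := {poly {poly K}}.
Local Notation e := (Pl_e lam).
Local Notation h := (Pl_h lam).
Local Notation f := (Pl_f lam).
Local Notation br := (@Pl_bracket K lam).
Variable emb : {rmorphism P -> R}.
Hypothesis embP : is_embedding q emb.
Implicit Types s t : poisson_aut br.

(** {s f, .} is the conjugate by s of {f, .} = d/dX. *)
Lemma ad_nilpotent s z : exists M, iter M (br (s f)) z = 0.
Proof.
set y := (s^-1)%g z; exists (size (emb y)); rewrite -(pautKV s z) -/y.
have iterE M : iter M (br (s f)) (s y) = s (iter M (br f) y).
  by elim: M => //= M ->; rewrite paut_br.
have embE M : emb (iter M (br f) y) = (emb y)^`(M).
  by elim: M => // M IH; rewrite iterS (emb_br_f embP) IH -derivnS.
rewrite iterE; have -> : iter (size (emb y)) (br f) y = 0.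
  by apply: (emb_inj charK0 embP); rewrite embE derivn_poly0 ?rmorph0.
exact: rmorph0.
Qed.

(** [rho] stands for the identity (B = 1) or for a substitution [puiseux]; only its effect on the
    bracket matters. *)
Lemma ad_leading (rho : R -> R) B al be s z r w u v : (0 < B)%N -> rho 0 = 0 ->
  (forall a b, jac (rho a) (rho b) = (B%:R *: 'X^(B.-1))%:P * rho (jac a b)) ->
  leading al be (rho (emb (s f))) r w -> leading al be (rho (emb z)) u v ->
  exists i : nat,
    w%:Z * u%:Z - r%:Z * v%:Z + i%:Z * (r%:Z * B%:Z - w%:Z) = 0.
Proof.
move=> B0 rho0 rhoJ lc lz; have [M zM] := ad_nilpotent s z.
pose zz i := rho (emb (iter i (br (s f)) z)).
have nB : B%:R != 0 :> K by rewrite (natf_eq0 charK0) -lt0n.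
apply: (@nilpotent_leading K charK0 al be (rho (emb (s f))) zz (B%:R^-1)
  B r w u v M) => //.
- by rewrite invr_eq0.
- move=> i; rewrite /zz /= (emb_br embP) rhoJ mulrA; congr (_ * _).
  by rewrite -!polyCM -!mul_polyC mulrA -polyCM mulVf // mul1r.
- by rewrite /zz zM rmorph0.
Qed.

(** Taking z = f, with leading monomial Z^B, gives i (rB - w) = rB > 0. *)
Lemma puiseux_bound A B xi al be s r w : (0 < B)%N ->
  leading al be (puiseux A B xi (emb (s f))) r w -> (0 < r)%N -> (w < r * B)%N.
Proof.
move=> B0 lc r0.
have lf : leading al be (puiseux A B xi (emb f)) 0 B.
  have cF u v : (puiseux A B xi (emb f))`_u`_v = ((u == 0%N) && (v == B))%:R.
    rewrite (emb_f embP) /embF /puiseux map_polyC /=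
      comp_polyX comp_polyC coefC.
    by case: u => [|u] /=; rewrite ?coef0 // coefXn.
  split=> [|u v]; rewrite cF ?eqxx ?oner_eq0 //.
  by case: andP => [[/eqP-> /eqP->] _ []|]; rewrite ?eqxx.
have [i] := ad_leading B0 (puiseux0 _ _ _) (jac_puiseux _ _ _) lc lf.
have : (0 < r * B)%N by rewrite muln_gt0 r0 B0.
rewrite mulr0 sub0r -PoszM; move: (r * B)%N => x x0; nia.
Qed.

(** z = f gives i (r - w) = r > 0, hence w < r. For al + be > 0 the leading monomial of e is X^2 f,
    and z = e gives r - 2w = j (r - w) >= 0. *)
Lemma leading_bound al be s r w : 0 < al + be ->
  leading al be (emb (s f)) r w -> (0 < r)%N -> (w.*2 <= r)%N.
Proof.
move=> ab lc r0.
have id1 a b : jac a b = (1%:R *: 'X^(1.-1))%:P * jac a b :> R.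
  by rewrite expr0 scale1r mul1r.
have lf : leading al be (emb f) 0 1.
  have cF u v : (emb f)`_u`_v = ((u == 0%N) && (v == 1%N))%:R.
    rewrite (emb_f embP) /embF coefC.
    by case: u => [|u] /=; rewrite ?coef0 // coefX.
  split=> [|u v]; rewrite cF ?eqxx ?oner_eq0 //.
  by case: andP => [[/eqP-> /eqP->] _ []|]; rewrite ?eqxx.
have le : leading al be (emb e) 2 1.
  have cE u v : (emb e)`_u`_v =
      - (q *+ ((u == 1%N) && (v == 0%N)) + ((u == 2%N) && (v == 1%N))%:R).
    rewrite (emb_e embP) /embE /embF !coefN coefXM.
    case: u => [|u] /=; first by rewrite coef0 mulr0n add0r.
    rewrite !coefD coefC coefMX coefC; case: u => [|[|u]] //=.
    - by rewrite coef0 addr0 coefC; case: v => [|v] //=;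
      rewrite ?mulr1n ?mulr0n addr0.
    - by rewrite coef0 coefX.
    - by rewrite !coef0.
  split=> [|u v]; rewrite cE /=; first by rewrite mulr0n add0r oppr_eq0
    oner_eq0.
  have [[/eqP-> /eqP->] _ _|_] := @andP (u == 1%N) (v == 0%N).
    by rewrite /wt; lia.
  rewrite mulr0n add0r; have [[/eqP-> /eqP->] _ []//|_] := @andP (u == 2%N)
    (v == 1%N).
  by rewrite oppr0 eqxx.
have [i] := ad_leading (rho := id) (ltnSn 0) erefl id1 lc lf.
have [j] := ad_leading (rho := id) (ltnSn 0) erefl id1 lc le.
move=> {le lf id1}; rewrite -muln2 !mulr0 !mulr1 !add0r => e1 e2; nia.
Qed.

(** The normal form in [P_lambda] gives one inequality ([lead_coef_emb]), nilpotency the other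
    ([leading_bound]). *)
Lemma size_lead_coef s : (1 < size (emb (s f)))%N ->
  (size (emb (s f))).-1 = (size (lead_coef (emb (s f)))).-1.*2.
Proof.
set c := emb (s f) => sc; have c0 : c != 0 by rewrite -size_poly_gt0 ltnW.
apply/eqP; rewrite eqn_leq (lead_coef_emb charK0 embP) //=.
pose Bg := (\max_(u < size c) size (c`_u)%R).+1.
have sB u : (size (c`_u)%R < Bg)%N.
  have [lt|ge] := ltnP u (size c); last by rewrite nth_default // size_poly0.
  by rewrite ltnS (leq_bigmax (Ordinal lt)).
set N := (size c).-1; set m := (size (lead_coef c)).-1.
(* With these weights the leading monomial is lexicographic, X first. *)
apply: (@leading_bound Bg%:Z 1 s N m) => //; last by rewrite /N;
  case: (size c) sc => [|[]].
split; first by rewrite -[c`_N]/(lead_coef c) -[_`_m]/(lead_coef (lead_coef c))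
  !lead_coef_eq0.
move=> u v nz ne; rewrite /wt !mul1r.
have vu : (v < size (c`_u)%R)%N.
  by rewrite ltnNge; apply/negP => le; rewrite nth_default ?eqxx in nz.
have uN : (u <= N)%N.
  rewrite -ltnS /N prednK ?size_poly_gt0 // ltnNge; apply/negP => le.
  by move: vu; rewrite nth_default // size_poly0.
have := sB u; have [uE|neq] := eqVneq u N; last by nia.
have vm : v <> m by move=> vE; apply: ne; rewrite uE vE.
have : (v <= m)%N by rewrite /m /lead_coef -/N -uE; case: (size _) vu.
rewrite uE; lia.
Qed.

End Nilpotent.

(** * Exclusion of edges of nonnegative slope *)

Section Edge.
Variables (K : closedFieldType) (lam q : K).
Hypothesis charK0 : [pchar K] =i pred0.
Local Notation P := (P_lambda lam).
Local Notation R := {poly {poly K}}.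
Local Notation e := (Pl_e lam).
Local Notation h := (Pl_h lam).
Local Notation f := (Pl_f lam).
Local Notation br := (@Pl_bracket K lam).
Variable emb : {rmorphism P -> R}.
Hypothesis embP : is_embedding q emb.
Implicit Types s t : poisson_aut br.

Lemma root_multiplicity (p : {poly K}) x : p != 0 -> root p x ->
  exists m r, [/\ p = r * ('X - x%:P) ^+ m, ~~ root r x, (0 < m)%N &
    (size p = size r + m)%N].
Proof.
move=> p0 px; have [m [r rx pE]] := multiplicity_XsubC p x.
rewrite p0 /= in rx; exists m, r; split=> //.
  by case: m pE => // pE; move: px rx; rewrite {1}pE expr0 mulr1 => ->.
rewrite pE size_Mmonic ?monic_exp ?monicXsubC //.
  by rewrite size_exp_XsubC addnS.
by apply: contraNneq p0 => r0; rewrite pE r0 mul0r.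
Qed.

(** Two distinct roots of multiplicity > n would exceed the degree 2n. *)
Lemma single_root (p : {poly K}) n : size p = n.*2.+1 -> (0 < n)%N ->
  (forall x m r, p = r * ('X - x%:P) ^+ m -> ~~ root r x -> (0 < m)%N ->
    (n < m)%N) ->
  exists x k, p = k%:P * ('X - x%:P) ^+ n.*2.
Proof.
move=> sp n0 mult; have p0 : p != 0 by rewrite -size_poly_gt0 sp.
have [x px] : exists x, root p x.
  by apply/closed_rootP; rewrite sp eqSS double_eq0 -lt0n.
have [m [r [pE rx m0 spE]]] := root_multiplicity p0 px.
have nm := mult x m r pE rx m0.
have r0 : r != 0 by apply: contraNneq p0 => r0; rewrite pE r0 mul0r.
have [sr|sr] := eqVneq (size r) 1%N.
  have /size_poly1P[k k0 rE] : size r == 1%N by rewrite sr.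
  exists x, k; rewrite pE rE; congr (_ * _ ^+ _).
  by move: spE; rewrite sp sr add1n => -[].
have /closed_rootP[y ry] := sr.
have py : root p y by rewrite pE rootM ry.
have [m' [r' [pE' ry' m'0 _]]] := root_multiplicity p0 py.
have nm' := mult y m' r' pE' ry' m'0.
have xy : x != y by apply: contraNneq rx => ->.
have : ('X - y%:P) ^+ m' %| r.
  have cop : coprimep (('X - y%:P) ^+ m') (('X - x%:P) ^+ m).
    apply: coprimep_expl; apply: coprimep_expr.
    by rewrite coprimep_XsubC root_XsubC.
  by rewrite -(Gauss_dvdpl _ cop) -pE pE' dvdp_mull.
move/(dvdp_leq r0); rewrite size_exp_XsubC.
move: spE; rewrite sp -addnn => e1 e2; exfalso;
  move: (size r) e1 e2 => z e1 e2; lia.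
Qed.

(** u0 maximizes (D u - m) / (N - u); the last clause, cleared of denominators, puts all points
    under the line through (N, m) and (u0, D u0). The point u1 makes the maximal slope
    nonnegative. *)
Lemma max_slope (N : nat) (D : nat -> nat) (Q : pred nat) m u1 :
  (u1 < N)%N -> Q u1 -> (m <= D u1)%N ->
  exists u0, [/\ (u0 < N)%N, Q u0, (m <= D u0)%N & forall u, (u < N)%N -> Q u ->
    (D u * (N - u0) + (D u0 - m) * u <= m * (N - u0) + (D u0 - m) * N)%N].
Proof.
move=> u1N Qu1 mu1.
pose F (i : 'I_N) : rat := ((D i)%:Q - m%:Q) / (N - i)%N%:Q.
have posN (i : 'I_N) : 0 < (N - i)%N%:Q by rewrite ltr0z ltz_nat subn_gt0.
case: (@arg_maxP _ _ _ (Ordinal u1N) (fun i : 'I_N => Q i) F Qu1) => i Qi imax.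
have mi : (m <= D i)%N.
  have := imax (Ordinal u1N) Qu1; rewrite /F => le.
  have : 0 <= ((D i)%:Q - m%:Q) / (N - i)%N%:Q.
    apply: le_trans le; apply: divr_ge0; last exact: ltW (posN (Ordinal u1N)).
    by rewrite subr_ge0 ler_int.
  by rewrite pmulr_lge0 ?invr_gt0 // subr_ge0 ler_int.
exists i; split=> // u uN Qu.
have : F (Ordinal uN) <= F i := imax (Ordinal uN) Qu.
rewrite /F ler_pdivrMr // [X in _ <= X]mulrAC ler_pdivlMr //= .
have iN := ltn_ord i.
rewrite -!rmorphB -!rmorphM ler_int /=.
move: (D u) (D i) mi => a b mb.
rewrite -!subzn ?(ltnW uN) ?(ltnW iN) //; nia.
Qed.

(** As N = 2m, a violation gives an edge of nonnegative slope at (N, m). All roots of its polynomial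
    have multiplicity > m, so it is k (X - x)^N; the bound on the coefficient of X^(N-1) gives x =
    0, leaving no other endpoint. *)
Lemma edge_bound s : let c := emb (s f) in let N := (size c).-1 in
  (0 < N)%N -> (size (c`_N.-1)%R <= (size (lead_coef c)).-1)%N ->
  forall u, c`_u != 0 -> ((size (c`_u)%R).-1.*2 < N + u)%N.
Proof.
move=> c N N0 trace u1 cu1; rewrite ltnNge; apply/negP => ge.
have sc : size c = N.+1 by rewrite /N; move: N0; rewrite /N; case: (size c).
pose m := (size (lead_coef c)).-1.
have Nm : N = m.*2 by apply: (size_lead_coef charK0 embP); rewrite sc.
have m0 : (0 < m)%N by move: N0; rewrite Nm double_gt0.
have cN0 : c`_N != 0 by rewrite -[c`_N]/(lead_coef c)
  lead_coef_eq0 -size_poly_gt0 sc.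
have leN u : c`_u != 0 -> (u <= N)%N.
  by move=> nz; rewrite -ltnS -sc ltnNge; apply: contra nz => le;
    rewrite nth_default.
pose D u := (size (c`_u)%R).-1.
have DN : D N = m by [].
have u1N : (u1 < N)%N.
  have := leN _ cu1; rewrite leq_eqVlt => /orP[/eqP u1E|//].
  by move: ge; rewrite u1E -/(D N) DN -addnn; lia.
have mu1 : (m <= D u1)%N by rewrite -leq_double -Nm (leq_trans (leq_addr u1 N)).
(* (u0, D u0) is the other end of the edge of largest slope at (N, m). *)
have [u0 [u0N cu0 mu0 slope]] := max_slope u1N (cu1 : (fun u => c`_u != 0) u1)
  mu1.
(* The edge lies on A u + B w = W, where w is the exponent of f; f = Z^B turns this into A u + v =
   W. *)
pose B := (N - u0)%N; pose A := (D u0 - m)%N; pose W := (m * B + A * N)%N.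
have B0 : (0 < B)%N by rewrite subn_gt0.
have coefB u v : (c`_u \Po 'X^B)`_v != 0 -> exists2 w,
  (v = w * B)%N & (w <= D u)%N /\ c`_u`_w != 0.
  rewrite coef_comp_poly_Xn //; case: ifP => [/dvdnP[w ->]|_];
    last by rewrite eqxx.
  rewrite mulnK // => nz; exists w => //; split=> //.
  rewrite /D -ltnS prednK; last first.
    by rewrite size_poly_gt0; apply: contraNneq nz => ->; rewrite coef0.
  by rewrite ltnNge; apply: contra nz => le; rewrite nth_default.
have Wmax u v : (u <= N)%N -> (c`_u \Po 'X^B)`_v != 0 -> (A * u + v <= W)%N.
  move=> uN /coefB[w -> [wD nz]].
  have cu : c`_u != 0 by apply: contraNneq nz => ->; rewrite coef0.
  have le : (w * B <= D u * B)%N by rewrite leq_mul2r wD orbT.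
  move: uN; rewrite leq_eqVlt => /orP[/eqP uE|uN].
    by move: le; rewrite uE DN /W; lia.
  by have := slope u uN cu; rewrite -/A -/B /W; lia.
have ANW : (A * N <= W)%N by rewrite leq_addl.
have scN : (size c <= N.+1)%N by rewrite sc.
pose C := edge_poly c N A B W.
have CE u : (u <= N)%N -> C`_u = (c`_u \Po 'X^B)`_(W - A * u).
  by move=> le; rewrite coef_poly ltnS le.
have CN : C`_N != 0.
  rewrite CE // /W addnK coef_comp_poly_Xn // dvdn_mull // mulnK //.
  by rewrite -[c`_N]/(lead_coef c) -[_`_m]/(lead_coef (lead_coef c))
    !lead_coef_eq0 -size_poly_gt0 sc.
have Cu0 : C`_u0 != 0.
  rewrite CE ?(ltnW u0N) //.
  have -> : (W - A * u0 = D u0 * B)%N.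
    have NE : (N = B + u0)%N by rewrite subnK // ltnW.
    have DE : (D u0 = A + m)%N by rewrite subnK.
    rewrite /W [X in (A * X)%N]NE DE mulnDr mulnDl; lia.
  rewrite coef_comp_poly_Xn // dvdn_mull // mulnK //.
  by rewrite -[_`_(D u0)]/(lead_coef (c`_u0)) lead_coef_eq0.
(* A term at X^(N-1) on the line would have f-degree m + A/B >= m, whereas the hypothesis bounds it
   strictly by m. *)
have CN1 : C`_N.-1 = 0.
  apply/eqP/negbNE/negP; rewrite CE ?leq_pred // => /coefB[w wE [_ nz]].
  have : (w < m)%N.
    rewrite ltnNge; apply: contra nz => le; rewrite nth_default //.
    by apply: leq_trans trace le.
  have AN1 : (A * N = A * N.-1 + A)%N by rewrite -mulnSr prednK.
  move: wE; rewrite /W => wE lt.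
  have : (w * B < m * B)%N by rewrite ltn_mul2r B0 lt.
  lia.
have sC : size C = N.+1.
  apply/eqP; rewrite eqn_leq size_poly /= ltnNge; apply: contra CN => le.
  by rewrite nth_default.
(* Shifting by the root makes (j, W - A j) the leading exponents. Then W - A j < j B, where W = m B
   + 2 m A, which fails for j <= m. *)
have mult x j r : C = r * ('X - x%:P) ^+ j -> ~~ root r x -> (0 < j)%N ->
  (m < j)%N.
  move=> CEr rx j0.
  have jN : (j <= N)%N.
    have r0 : r != 0 by apply: contraNneq CN => r0; rewrite CEr r0 mul0r coef0.
    have : (size C = size r + j)%N.
      by rewrite CEr size_Mmonic ?monic_exp ?monicXsubC // size_exp_XsubC addnS.
    have : (0 < size r)%N by rewrite size_poly_gt0.
    rewrite sC; lia.
  have ld := puiseux_leading scN ANW Wmax CEr rx jN.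
  have := puiseux_bound charK0 embP B0 ld j0.
  have jA : (A * j <= W)%N by apply: leq_trans ANW; rewrite leq_mul2l jN orbT.
  rewrite ltn_subLR // /W Nm -addnn ltnNge => lt; rewrite ltnNge;
    apply: contra lt => jm.
  have : (j * B <= m * B)%N by rewrite leq_mul2r jm orbT.
  have : (A * j <= A * m)%N by rewrite leq_mul2l jm orbT.
  rewrite mulnDr; lia.
have sC' : size C = m.*2.+1 by rewrite sC -Nm.
have [x [k Ck]] := single_root sC' m0 mult; rewrite -Nm in Ck.
have k0 : k != 0 by apply: contraNneq CN => k0; rewrite Ck k0 mul0r coef0.
(* The coefficient of X^(N-1) in k (X - x)^N is -N k x. *)
have x0 : x = 0.
  move: CN1; rewrite Ck coefCM => /eqP; rewrite mulf_eq0 (negPf k0) /=.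
  have := @coefPn_prod_XsubC K (nseq N x).
  rewrite size_nseq -lt0n => /(_ N0); rewrite !big_nseq iter_mulr_1 iter_addr_0.
  move=> ->; rewrite oppr_eq0 -mulr_natl mulf_eq0 (natf_eq0 charK0).
  by rewrite (gtn_eqF N0) => /eqP.
by case/eqP: Cu0; rewrite Ck x0 subr0 coefCM coefXn (ltn_eqF u0N) mulr0.
Qed.

End Edge.

(** * Linear and triangular automorphisms *)

Section Linear.
Variables (K : fieldType) (lam q : K).
Hypothesis charK0 : [pchar K] =i pred0.
Local Notation P := (P_lambda lam).
Local Notation R := {poly {poly K}}.
Local Notation e := (Pl_e lam).
Local Notation h := (Pl_h lam).
Local Notation f := (Pl_f lam).
Local Notation br := (@Pl_bracket K lam).
Variable emb : {rmorphism P -> R}.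
Hypothesis embP : is_embedding q emb.
Local Notation A := (linear_auts lam).
Local Notation T := (triangular_auts lam).
Local Notation lc := (lincomb (Pl_gen lam)).
Implicit Types s t : Aut_P_lambda lam.

Lemma lincombD u v : lc (u + v) = lc u + lc v.
Proof.
rewrite /lincomb -big_split; apply: eq_bigr => i _ /=.
by rewrite mxE scalerDl.
Qed.

Lemma lincombZ a u : lc (a *: u) = a *: lc u.
Proof.
rewrite /lincomb scaler_sumr; apply: eq_bigr => i _.
by rewrite mxE scalerA.
Qed.

Lemma lincombE u : lc u = u 0 iE *: e + u 0 iH *: h + u 0 iF *: f.
Proof. exact: big_I3. Qed.

Lemma lincomb_inj : injective lc.
Proof.
suff inj0 u : lc u = 0 -> u = 0.
  move=> u v uv; apply/eqP; rewrite -subr_eq0; apply/eqP/inj0.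
  by rewrite -scaleN1r lincombD lincombZ uv scaleN1r subrr.
rewrite lincombE => /(congr1 emb); rewrite rmorph0 !rmorphD !(embZ embP).
rewrite (emb_e embP) (emb_h embP) (emb_f embP) => u0.
(* The coordinates are read off in turn from the monomials X^2 f, X f and f. *)
have cf : (u 0 iE)%:P%:P * embE q + (u 0 iH)%:P%:P * embH q
    + (u 0 iF)%:P%:P * embF K =
  (- (u 0 iE * q)%:P + (2 * u 0 iH) *: 'X)%:P * 'X + (-
    (u 0 iE *: 'X))%:P * 'X ^+ 2
    + (u 0 iH * q)%:P%:P + (u 0 iF *: 'X)%:P.
  rewrite /embE /embH /embF -!mul_polyC.
  rewrite !(rmorphD, rmorphN, rmorphM) /= !polyC1; ring.
move: u0; rewrite cf => u0.
have c i j := congr1 (fun p : R => p`_i`_j) u0.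
have uE : u 0 iE = 0.
  have := c 2%N 1%N; rewrite !(coefD, coefMX, coefMXn, coefC, coefN, coefZ,
    coefX, coef0) /=.
  by rewrite !add0r !addr0 mulr1 => /eqP; rewrite oppr_eq0 => /eqP.
have uH : u 0 iH = 0.
  have := c 1%N 1%N; rewrite !(coefD, coefMX, coefMXn, coefC, coefN, coefZ,
    coefX, coef0) /=.
  rewrite oppr0 !add0r !addr0 mulr1 => /eqP;
    rewrite mulf_eq0 (negPf (two_neq0 charK0)).
  by move/eqP.
have uF : u 0 iF = 0.
  have := c 0%N 1%N; rewrite !(coefD, coefMX, coefMXn, coefC, coefN, coefZ,
    coefX, coef0) /=.
  by rewrite !add0r mulr1.
by apply/rowP; apply: I3_ind; rewrite mxE.
Qed.

(** Bijectivity and bracket compatibility of the matrix are inherited from s through the injectivity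
    of [lincomb]. *)
Lemma linear_autP s : (forall i, exists u, s (Pl_gen lam i) = lc u) -> A s.
Proof.
move=> sg; pose w i := projT1 (cid (sg i)).
have wE i : s (Pl_gen lam i) = lc (w i) by rewrite /w; case: cid.
pose W : 'M[K]_3 := \matrix_(i, j) w i 0 j.
pose phi : {linear 'rV[K]_3 -> 'rV[K]_3} := mulmxr W.
have phiE u : s (lc u) = lc (phi u).
  have -> : phi u = \sum_i u 0 i *: w i.
    by apply/rowP => j; rewrite /phi /= !mxE summxE; apply: eq_bigr => i _;
      rewrite !mxE.
  rewrite /lincomb linear_sum /= -/(lc _).
  rewrite !big_I3 !lincombD !lincombZ -!wE.
  by rewrite !linearZ.
exists phi => //; split; last first.
  move=> u v; apply: lincomb_inj.
  by rewrite -phiE -!Pl_bracket_lin -!phiE paut_br.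
have Wu : W \in unitmx.
  rewrite -row_free_unit; apply/inj_row_free => u uW.
  apply: lincomb_inj; apply: (@paut_inj _ _ _ s); rewrite phiE /phi /= uW.
  have l0 : lc 0 = 0 by rewrite -(scale0r 0) lincombZ scale0r.
  by rewrite l0 rmorph0.
exists (mulmxr (invmx W)) => u; first exact: mulmxK.
exact: mulmxKV.
Qed.

Lemma linear_aut_gen s i : A s -> exists u, s (Pl_gen lam i) = lc u.
Proof. by case=> phi _ sE; exists (phi (delta_mx 0 i));
  rewrite -sE lincomb_delta. Qed.

Lemma linear_aut_lincomb s u : A s -> exists v, s (lc u) = lc v.
Proof. by case=> phi _ sE; exists (phi u). Qed.

Lemma linear_subgroup : is_subgroup A.
Proof.
split=> [|s t sA tA|s sA]; first 1 last.
- apply: linear_autP => i; have [u tu] := linear_aut_gen i tA.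
  by have [v sv] := linear_aut_lincomb u sA; exists v; rewrite -sv -tu.
- have [phi [[g gK gK'] _] sE] := sA; apply: linear_autP => i.
  exists (g (delta_mx 0 i)); apply: (@paut_inj _ _ _ s).
  by rewrite pautKV sE gK' lincomb_delta.
- by apply: linear_autP => i; exists (delta_mx 0 i); rewrite lincomb_delta.
Qed.

Lemma triangular_subgroup : is_subgroup T.
Proof.
split=> [|s t|s]; [exact: generated_1|exact: generated_M|exact: generated_V].
Qed.

Lemma Delta_triangular g D : is_Delta g D -> T D.
Proof. by move=> DP; apply: generated_in; left; exists g. Qed.

Lemma Hrot_triangular nu H : nu != 0 -> is_Hrot nu H -> T H.
Proof. by move=> nu0 HP; apply: generated_in; right; exists nu. Qed.

Lemma triangular_line t : T t -> exists2 al, al != 0 & t f = al *: f.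
Proof.
elim=> {t} [s [[g [_ _ sf]]|[nu nu0 [_ _ sf]]]||s t _ [a a0 sa]
  _ [b b0 tb]|s _ [a a0 sa]].
- by exists 1; rewrite ?oner_eq0 // scale1r.
- by exists nu^-1; rewrite ?invr_eq0.
- by exists 1; rewrite ?oner_eq0 // scale1r.
- by exists (b * a); rewrite ?mulf_neq0 // paut_mulE tb linearZ /= sa scalerA.
- exists a^-1; rewrite ?invr_eq0 //; apply: (@paut_inj _ _ _ s).
  by rewrite pautKV linearZ /= sa scalerA mulVf // scale1r.
Qed.

(** Every generator preserves the line K f, so [triangular_form] collapses any word in the
    generators to one product. *)
Lemma triangularP s : T s <-> exists g nu D H,
  [/\ nu != 0, is_Delta g D, is_Hrot nu H & s = (D * H)%g].
Proof.
split=> [/triangular_line[a a0 sa]|[g [nu [D [H [nu0 DP HP ->]]]]]].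
  apply: (@triangular_form _ _ _ charK0 _ embP s (a *: 'X)).
  by rewrite sa (embZ embP) (emb_f embP) -mul_polyC polyCM.
by apply: generated_M; [exact: Delta_triangular DP|exact: Hrot_triangular HP].
Qed.

Lemma omega_linear s : is_omega s -> A s.
Proof.
move=> [se sh sf]; apply: linear_autP; apply: I3_ind.
- by exists (- delta_mx 0 iF); rewrite -scaleN1r lincombZ lincomb_delta
  scaleN1r.
- by exists (- delta_mx 0 iH); rewrite -scaleN1r lincombZ lincomb_delta
  scaleN1r.
- by exists (- delta_mx 0 iE); rewrite -scaleN1r lincombZ lincomb_delta
  scaleN1r.
Qed.

(** The line through s f is a point of the conic b^2 + pr = 0. The point p = 0 is K f, which makes s
    triangular; the others are parametrized by a = -b/p. *)
Lemma linear_nontriangular s : A s -> ~ T s ->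
  exists p a, p != 0 /\ s f = p *: (e - a *: h - a ^+ 2 *: f).
Proof.
move=> [phi [_ phiB] sE] nT.
pose v := phi (sl2_F K); pose w := phi (sl2_H K).
have sf : s f = v 0 iE *: e + v 0 iH *: h + v 0 iF *: f.
  by rewrite -lincombE /v -sE lincomb_delta.
have wv : sl2_bracket w v = (- 2) *: v by rewrite -phiB sl2_HF linearZ.
have := congr1 (fun u : 'rV[K]_3 => u 0 iE) wv.
have := congr1 (fun u : 'rV[K]_3 => u 0 iH) wv.
have := congr1 (fun u : 'rV[K]_3 => u 0 iF) wv.
rewrite /sl2_bracket !mxE /= !(mulr0, mulr1, addr0, add0r).
move: (v 0 iE) (v 0 iH) (v 0 iF) (w 0 iE) (w 0 iH) (w 0 iF) sf.
move=> p b r wE wH wF sf eF eH eE.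
(* s f is nilpotent in sl_2, as f is. *)
have quad : b ^+ 2 + p * r = 0.
  apply: (mulfI (_ : 4 != 0 :> K)); first by rewrite (natf_eq0 charK0 4).
  rewrite mulr0; transitivity (- (2 * b * (- 2 * b) + r * (- 2 * p) + p *
    (- 2 * r))); first by ring.
  by rewrite -eE -eH -eF; ring.
have [p0|p0] := eqVneq p 0.
  have b0 : b = 0 by apply/eqP; move: quad; rewrite p0 mul0r addr0 => /eqP;
    rewrite expf_eq0.
  case: nT; apply/triangularP.
  apply: (@triangular_form _ _ _ charK0 _ embP s (r *: 'X)).
  by rewrite sf p0 b0 !scale0r !add0r (embZ embP) (emb_f embP)
    -mul_polyC polyCM.
exists p, (- b / p); split=> //; rewrite sf !scalerBr !scalerA.
have -> : p * (- b / p) = - b by rewrite mulrC divfK.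
have -> : p * (- b / p) ^+ 2 = - r.
  apply: (mulfI p0); rewrite mulrN; transitivity (b ^+ 2); first by field.
  by apply/eqP; rewrite -subr_eq0 opprK quad.
by rewrite !scaleNr !opprK.
Qed.

(** Hyperbolic rotations and Delta_g with g constant are linear, so g must have positive degree. *)
Lemma triangular_nonlinear t : T t -> ~ A t -> exists g nu D H,
  [/\ nu != 0, is_Delta g D, is_Hrot nu H, t = (D * H)%g & (1 < size g)%N].
Proof.
move=> /triangularP[g [nu [D [H [nu0 DP HP tE]]]]] nA.
exists g, nu, D, H; split=> //; rewrite ltnNge; apply/negP => sg.
apply: nA; have [_ AM _] := linear_subgroup; rewrite tE.
have lcE (a b c : K) : exists u, a *: e + b *: h + c *: f = lc u.
  exists (a *: delta_mx 0 iE + b *: delta_mx 0 iH + c *: delta_mx 0 iF).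
  by rewrite !lincombD !lincombZ !lincomb_delta.
apply: AM; apply: linear_autP; apply: I3_ind.
- have [De _ _] := DP; have := size1_polyC sg; set c := g`_0 => gE.
  have [u uE] := lcE 1 (- c) (- c ^+ 2); exists u;
    rewrite -uE [LHS]De gE horner_algC.
  by rewrite mulr_algl expr2 mulrA !mulr_algr scalerA -expr2 scale1r !scaleNr.
- have [_ Dh _] := DP; have := size1_polyC sg; set c := g`_0 => gE.
  have [u uE] := lcE 0 1 (2 * c); exists u; rewrite -uE [LHS]Dh gE horner_algC.
  by rewrite mulr_algr scale0r add0r scale1r [2 * c]mulrC -scalerA scaler_nat
    mulr_natl.
- have [_ _ Df] := DP; have [u uE] := lcE 0 0 1; exists u; rewrite -uE [LHS]Df.
  by rewrite !scale0r !add0r scale1r.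
- have [He _ _] := HP; have [u uE] := lcE nu 0 0; exists u; rewrite -uE [LHS]He.
  by rewrite !scale0r !addr0.
- have [_ Hh _] := HP; have [u uE] := lcE 0 1 0; exists u; rewrite -uE [LHS]Hh.
  by rewrite !scale0r addr0 add0r scale1r.
- have [_ _ Hf] := HP; have [u uE] := lcE 0 0 nu^-1; exists u;
  rewrite -uE [LHS]Hf.
  by rewrite !scale0r !add0r.
Qed.

End Linear.

(** * Generation *)

Section Generation.
Variables (K : closedFieldType) (lam q : K).
Hypothesis charK0 : [pchar K] =i pred0.
Local Notation P := (P_lambda lam).
Local Notation R := {poly {poly K}}.
Local Notation e := (Pl_e lam).
Local Notation h := (Pl_h lam).
Local Notation f := (Pl_f lam).
Variable emb : {rmorphism P -> R}.
Hypothesis embP : is_embedding q emb.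
Local Notation A := (linear_auts lam).
Local Notation T := (triangular_auts lam).
Implicit Types s t : Aut_P_lambda lam.

(** The shift adds (N + 1) g lc(c) to the coefficient of X^N; g is chosen by Euclidean division so
    that only the remainder stays. *)
Lemma tschirnhaus (c : R) N : size c = N.+2 -> exists g : {poly K},
  let c' := c \Po ('X + g%:P) in [/\ size c' = N.+2,
    lead_coef c' = lead_coef c &
    (size (c'`_N)%R <= (size (lead_coef c)).-1)%N].
Proof.
move=> sc; pose d := N.+1%:R *: lead_coef c; exists (- (c`_N %/ d)) => c'.
have cE j : c'`_j = \sum_(u < N.+2) c`_u * ((- (c`_N %/ d)) ^+ (u - j) *+ 'C(u,
  j)).
  by apply: coef_comp_XaddC; rewrite sc.
have n0 : N.+1%:R != 0 :> K by rewrite (natf_eq0 charK0).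
have cN0 : lead_coef c != 0 by rewrite lead_coef_eq0 -size_poly_gt0 sc.
have sc' : size c' = N.+2 by rewrite size_comp_poly2 // size_XaddC.
have cN : c`_N.+1 = lead_coef c by rewrite lead_coefE sc.
split=> //.
  rewrite lead_coefE sc' /= cE big_ord_recr /= subnn expr0 binn mulr1 cN.
  rewrite big1 ?add0r // => u _; rewrite bin_small ?mulr0n ?mulr0 //.
rewrite cE !big_ord_recr /= big1 => [|u _];
  last by rewrite bin_small ?mulr0n ?mulr0.
rewrite subnn expr0 binn mulr1 add0r subSnn expr1 binSn cN.
have -> : c`_N + lead_coef c * (- (c`_N %/ d) *+ N.+1) = c`_N %% d.
  have -> : lead_coef c * (- (c`_N %/ d) *+ N.+1) = - (c`_N %/ d * d).
    move: (c`_N %/ d) => Q; rewrite mulNrn mulrN mulrnAr /d -scalerAr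
      scaler_nat.
    by rewrite [lead_coef c * _]mulrC.
  by rewrite {1}(divp_eq c`_N d) addrAC subrr add0r.
have d0 : d != 0 by rewrite scaler_eq0 negb_or n0.
rewrite -ltnS prednK ?size_poly_gt0 //.
by have := ltn_modp c`_N d; rewrite d0 size_scale.
Qed.

(** Descent on the X-degree of s f: Delta_g normalizes without changing it, [edge_bound] then
    applies, and omega lowers it. In degree 0, s is triangular. *)
Lemma generation s : exists2 w, amalgam_word A T w & word_val w = s.
Proof.
have word_consV b a x : factor A T b a ->
    (exists2 w, amalgam_word A T w & word_val w = (a * x)%g) ->
    exists2 w, amalgam_word A T w & word_val w = x.
  move=> fa [w ww wE]; exists ((b, (a^-1)%g) :: w).
    apply/amalgam_word_cons; split=> //=.
    by case: b fa => fa; [have [_ _ V] := triangular_subgroup lam|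
                          have [_ _ V] := linear_subgroup charK0 embP];
                            apply: V.
  by rewrite word_val_cons wE /= mulKg.
have [n] := ubnP (size (emb (s f))); elim: n s => // n IH s.
case sz : (size (emb (s f))) => [|[|N]] ltn.
- exists [:: (true, s)]; last by rewrite word_val_cons /word_val big_nil mulg1.
  apply/amalgam_word_cons; split=> //; apply/(triangularP charK0 embP).
  apply: (triangular_form charK0 embP (r := 0)).
  by apply/eqP; rewrite polyC0 -size_poly_eq0 sz.
- exists [:: (true, s)]; last by rewrite word_val_cons /word_val big_nil mulg1.
  apply/amalgam_word_cons; split=> //; apply/(triangularP charK0 embP).
  apply: (triangular_form charK0 embP (r := (emb (s f))`_0)).
  by apply: size1_polyC; rewrite sz.
have [g [sz' lc' trace]] := tschirnhaus sz.
have [D DP] := Delta_ex lam g; have [om omP] := omega_ex lam.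
apply: (word_consV true D); first exact: Delta_triangular DP.
apply: (word_consV false om); first exact: (omega_linear charK0 embP omP).
apply: IH; rewrite -(emb_Delta embP _ DP) -[D (s f)]/((D * s)%g f)
  in sz' lc' trace.
apply: leq_ltn_trans (_ : _ <= N.+1)%N _; last by [].
have := @edge_bound _ _ _ charK0 _ embP (D * s)%g; cbv zeta.
rewrite sz' /= lc' => /(_ isT trace) bound.
exact: (size_emb_swap embP omP bound).
Qed.

End Generation.

(** * Reduced words do not fix f *)

Section Filtration.
Variables (K : fieldType) (lam q : K).
Hypothesis charK0 : [pchar K] =i pred0.
Local Notation P := (P_lambda lam).
Local Notation R := {poly {poly K}}.
Local Notation e := (Pl_e lam).
Local Notation h := (Pl_h lam).
Local Notation f := (Pl_f lam).
Local Notation br := (@Pl_bracket K lam).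
Variable emb : {rmorphism P -> R}.
Hypothesis embP : is_embedding q emb.
Local Notation A := (linear_auts lam).
Local Notation T := (triangular_auts lam).
Implicit Types (s t : poisson_aut br) (x y : P).

(** Upper bounds for the degree of some representative in e, h, f; no degree function on the
    quotient is required. *)
Inductive filtered : nat -> P -> Prop :=
| fil_C c : filtered 0 c%:A
| fil_gen i : filtered 1 (Pl_gen lam i)
| fil_D k x y : filtered k x -> filtered k y -> filtered k (x + y)
| fil_M k l x y : filtered k x -> filtered l y -> filtered (k + l) (x * y)
| fil_le k l x : (k <= l)%N -> filtered k x -> filtered l x.

Lemma fil_const k c : filtered k c%:A.
Proof. exact: fil_le (fil_C c). Qed.

Lemma fil_Z k a x : filtered k x -> filtered k (a *: x).
Proof. by rewrite -mulr_algl -[k]add0n; apply/fil_M/fil_C. Qed.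

Lemma fil_N k x : filtered k x -> filtered k (- x).
Proof. by rewrite -scaleN1r; apply: fil_Z. Qed.

Lemma fil_B k x y : filtered k x -> filtered k y -> filtered k (x - y).
Proof. by move=> fx fy; apply: fil_D fx (fil_N fy). Qed.

Lemma fil_0 k : filtered k 0.
Proof. by rewrite -(scale0r 1); apply: fil_const. Qed.

Lemma fil_X k x n : filtered k x -> filtered (k * n) (x ^+ n).
Proof.
move=> fx; elim: n => [|n IH]; first by rewrite expr0 -(scale1r 1);
  apply: fil_const.
by rewrite exprS mulnS; apply: fil_M.
Qed.

Lemma fil_paut s d k x : (forall i, filtered d (s (Pl_gen lam i))) ->
  filtered k x -> filtered (d * k) (s x).
Proof.
move=> sd; elim=> {k x} [c|i|k x y _ IHx _ IHy|k l x y _ IHx _ IHy|k l x le _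
  IHx].
- by rewrite paut_algC; apply: fil_const.
- by rewrite muln1.
- by rewrite rmorphD; apply: fil_D.
- by rewrite rmorphM mulnDr; apply: fil_M.
- by apply: fil_le IHx; rewrite leq_mul2l le orbT.
Qed.

(** Detects that an element is not of low filtration degree, by specializing e, h, f to polynomials
    of degree at most 1. *)
Lemma size_fil k x (F : {rmorphism P -> {poly K}}) :
  (forall c, F c%:A = c%:P) -> (forall i, (size (F (Pl_gen lam i)) <= 2)%N) ->
  filtered k x -> (size (F x) <= k.+1)%N.
Proof.
move=> FC Fg; elim=> {k x} [c|i|k x y _ IHx _ IHy|k l x y _ IHx _ IHy|k l x le
  _ IHx].
- by rewrite FC size_polyC_leq1.
- exact: Fg.
- by rewrite rmorphD (leq_trans (size_polyD _ _)) // geq_max IHx.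
- rewrite rmorphM (leq_trans (size_polyMleq _ _)) //.
  move: (size (F x)) (size (F y)) IHx IHy => a b; lia.
- exact: leq_trans IHx _.
Qed.

(** The top part is prescribed modulo lower filtration degree. The predecessor has this meaning for
    M > 0. *)
Definition top_pow (v : P) M x : Prop := exists c y,
  [/\ c != 0, filtered M.-1 y & x = c *: v ^+ M + y].

Lemma top_powM k l x y : (0 < k)%N -> (0 < l)%N ->
  top_pow f k x -> top_pow f l y -> top_pow f (k + l) (x * y).
Proof.
move=> k0 l0 [c [x' [c0 fx ->]]] [d [y' [d0 fy ->]]].
exists (c * d), (c *: f ^+ k * y' + x' * (d *: f ^+ l) + x' * y').
have ff n : filtered n (f ^+ n) by rewrite -{1}[n]mul1n; apply/fil_X/fil_gen.
split; first exact: mulf_neq0.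
  apply: fil_D; [apply: fil_D|].
  - by apply: fil_le (fil_M (fil_Z c (ff k)) fy); lia.
  - by apply: fil_le (fil_M fx (fil_Z d (ff l))); lia.
  - by apply: fil_le (fil_M fx fy); lia.
have -> : (c * d) *: f ^+ (k + l) = (c *: f ^+ k) * (d *: f ^+ l).
  by rewrite -scalerAl -scalerAr scalerA exprD.
by ring.
Qed.

Lemma top_powX k x n : (0 < k)%N -> (0 < n)%N ->
  top_pow f k x -> top_pow f (k * n) (x ^+ n).
Proof.
move=> k0; case: n => // n _ fx; elim: n => [|n IH]; first by rewrite muln1.
by rewrite exprS mulnS; apply: top_powM; rewrite ?muln_gt0 ?k0.
Qed.

(** Linear automorphisms preserve the filtration, and s f is a multiple of e - ah - a^2 f. *)
Lemma linear_step s M x : (0 < M)%N -> A s -> ~ T s -> top_pow f M x ->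
  exists a, top_pow (e - a *: h - a ^+ 2 *: f) M (s x).
Proof.
move=> M0 sA nT [c [y [c0 fy ->]]].
have [p [a [p0 sf]]] := linear_nontriangular charK0 embP sA nT.
exists a, (c * p ^+ M), (s y); split; first by rewrite mulf_neq0 ?expf_neq0.
  rewrite -[M.-1]mul1n; apply: fil_paut fy => i.
  have [u ->] := linear_aut_gen i sA; rewrite lincombE.
  by do 2?[apply: fil_D]; apply/fil_Z/fil_gen.
rewrite rmorphD /= linearZ /=.
by rewrite rmorphXn [X in X ^+ _]sf exprZn scalerA.
Qed.

Lemma horner_alg_top (g : {poly K}) : (1 < size g)%N -> exists z,
  filtered (size g).-2 z /\
  horner_alg f g = lead_coef g *: f ^+ (size g).-1 + z.
Proof.
move=> sg; exists (\sum_(i < (size g).-1) g`_i *: f ^+ i); split.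
  apply: (big_ind (filtered _)) => [||i _]; [exact: fil_0|exact: fil_D|].
  apply/fil_Z; apply: (@fil_le i); first by have := ltn_ord i; lia.
  by rewrite -{1}[nat_of_ord i]mul1n; apply/fil_X/fil_gen.
rewrite -{1}[g]coefK poly_def rmorph_sum lead_coefE /=.
case: (size g) sg => // n _; rewrite big_ord_recr /=.
have hE i : horner_alg f (g`_i *: 'X^i) = g`_i *: f ^+ i.
  by rewrite linearZ /= rmorphXn /= horner_algX mulr_algl.
by rewrite hE addrC; congr (_ + _); apply: eq_bigr.
Qed.

(** With d = deg g > 0, t e has top term a multiple of f^(2d+1), whereas t h and t f have degrees at
    most d + 1 and 1. Hence M' = (2d + 1) M. *)
Lemma triangular_step t M a x : (0 < M)%N -> T t -> ~ A t ->
  top_pow (e - a *: h - a ^+ 2 *: f) M x ->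
  exists2 M', (1 < M')%N & top_pow f M' (t x).
Proof.
move=> M0 tT nA [c [y [c0 fy ->]]].
have [g [nu [D [H [nu0 DP HP tE sg]]]]] := triangular_nonlinear charK0 embP tT
  nA.
have [z [fz gE]] := horner_alg_top sg.
have [De Dh Df] := DP; have [He Hh Hf] := HP.
pose d := (size g).-1; pose l := lead_coef g; pose gf := horner_alg f g.
have dE : (size g).-1 = d by []. have dE' : (size g).-2 = d.-1 by [].
have d0 : (0 < d)%N by rewrite /d; lia.
have l0 : l != 0 by rewrite lead_coef_eq0 -size_poly_gt0 ltnW.
have te : t e = nu *: (e - gf * h - f * gf ^+ 2).
  by rewrite tE paut_mulE He linearZ /= De.
have th : t h = h + 2 * f * gf by rewrite tE paut_mulE Hh Dh.
have tf : t f = nu^-1 *: f by rewrite tE paut_mulE Hf linearZ /= Df.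
have fe : filtered 1 e by exact: fil_gen.
have fh : filtered 1 h by exact: fil_gen.
have ff : filtered 1 f by exact: fil_gen.
have fd n : filtered n (f ^+ n) by rewrite -{1}[n]mul1n; apply/fil_X.
have fg : filtered d gf.
  rewrite /gf gE dE; apply: fil_D; first exact/fil_Z.
  by apply: fil_le fz; lia.
have fth : filtered d.+1 (t h).
  rewrite th mulrAC -mulrA mulr_natl; apply: fil_D; first by apply: fil_le fh;
    lia.
  by rewrite -scaler_nat -addn1; apply/fil_Z/fil_M.
have ftf : filtered 1 (t f) by rewrite tf; apply: fil_Z.
have gh : filtered d.+1 (gf * h) by rewrite -addn1; apply: fil_M.
have fgg : exists2 r, filtered d.*2 r & f * gf ^+ 2 = l ^+ 2 *: f ^+ d.*2.+1
  + r.
  exists (2 *: (l *: (f * f ^+ d * z)) + f * z ^+ 2).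
    apply: fil_D.
      by do 2 apply: fil_Z; apply: fil_le (fil_M (fil_M ff (fd d)) fz); lia.
    by apply: fil_le (fil_M ff (fil_X 2 fz)); lia.
  rewrite /gf gE -/l dE sqrrD exprZn -exprM muln2 [f ^+ _.+1]exprS mulrDr
    mulrDr -scalerAr -addrA.
  by congr (_ + (_ + _)); rewrite mulrnAr -scalerAl -scalerAr mulrA scaler_nat.
have [r fr gg] := fgg.
have topv : top_pow f d.*2.+1 (t (e - a *: h - a ^+ 2 *: f)).
  (* The coefficient comes from the term - f g(f)^2 of Delta_g(e), scaled by H_nu. *)
  exists (- (nu * l ^+ 2)), (nu *: (e - gf * h - r) - a *: t h - a ^+ 2 *: t f).
  split; first by rewrite oppr_eq0 mulf_neq0 ?expf_neq0.
    apply: fil_B; [apply: fil_B|]; apply: fil_Z.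
    - apply: fil_B => //; apply: fil_B; first by apply: fil_le fe; lia.
      by apply: fil_le gh; lia.
    - by apply: fil_le fth; lia.
    - by apply: fil_le ftf; lia.
  rewrite !rmorphB /= !linearZ /= te gg.
  rewrite !scalerBr !scalerDr !scaleNr scalerA; ring.
have fgen i : filtered d.*2.+1 (t (Pl_gen lam i)).
  move: i; apply: I3_ind.
  - rewrite [t _]te; apply/fil_Z/fil_B; [apply: fil_B|].
    + by apply: fil_le fe; lia.
    + by apply: fil_le gh; lia.
    + by apply: fil_le (fil_M ff (fil_X 2 fg)); lia.
  - by apply: fil_le fth; lia.
  - by apply: fil_le ftf; lia.
exists (d.*2.+1 * M)%N; first by nia.
have [c' [y' [c'0 fy' vE]]] := top_powX (ltn0Sn _) M0 topv.
exists (c * c'), (c *: y' + t y); split; first exact: mulf_neq0.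
  apply: fil_D; first exact: fil_Z.
  by apply: fil_le (fil_paut fgen fy); nia.
by rewrite rmorphD /= linearZ /= rmorphXn vE scalerDr scalerA addrA.
Qed.

(* The evaluation X = x0. *)
Lemma eval_ex (x0 : K) : exists F : {rmorphism P -> {poly K}},
  [/\ forall c, F c%:A = c%:P, forall i, (size (F (Pl_gen lam i)) <= 2)%N,
    F f = 'X & forall a, F (e - a *: h - a ^+ 2 *: f) =
      - ((x0 + a) * q)%:P - (x0 + a) ^+ 2 *: 'X].
Proof.
pose F : {rmorphism P -> {poly K}} := horner_eval x0%:P \o emb.
have FC c : F c%:A = c%:P by rewrite /F /= (embC embP) /horner_eval hornerC.
have FZ c x : F (c *: x) = c%:P * F x by rewrite -mulr_algl rmorphM FC.
have Ff : F f = 'X by rewrite /F /= (emb_f embP) /horner_eval hornerC.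
have Fh : F h = (2 * x0) *: 'X + q%:P.
  rewrite /F /= (emb_h embP) /horner_eval embH_poly hornerD hornerMX !hornerC.
  by rewrite -mul_polyC polyCM polyC_natr; ring.
have Fe : F e = (- x0 ^+ 2) *: 'X + (- (x0 * q))%:P.
  rewrite /F /= (emb_e embP) /horner_eval embE_poly hornerMX hornerD hornerMX
    !hornerC.
  by rewrite -mul_polyC !(polyCN, polyCM, polyC_exp); ring.
have sz (a b : K) : (size (a *: 'X + b%:P)%R <= 2)%N.
  rewrite -mul_polyC size_MXaddC; case: ifP => // _.
  by rewrite ltnS size_polyC_leq1.
exists F; split=> //; first by apply: I3_ind;
  rewrite ?[F _]Fe ?[F _]Fh ?[F _]Ff ?size_polyX.
move=> a; rewrite !rmorphB !FZ Fe Fh Ff -!mul_polyC.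
by rewrite !(polyCN, polyCM, polyC_exp, polyCD) ?polyC1; ring.
Qed.

(** For M > 1, the evaluation X = 0 would leave c f^M uncancelled in the image of f. *)
Lemma top_pow_f M : top_pow f M f -> (M <= 1)%N.
Proof.
move=> [c [y [c0 fy fE]]]; rewrite leqNgt; apply/negP => M1.
have [F [FC Fg Ff _]] := eval_ex 0.
have FZ k x : F (k *: x) = k *: F x by rewrite -mulr_algl rmorphM FC mul_polyC.
have := congr1 (fun x => (F x)`_M) fE; rewrite rmorphD FZ rmorphXn Ff.
rewrite coefX coefD coefZ coefXn eqxx (gtn_eqF M1) nth_default; last first.
  by apply: leq_trans (size_fil FC Fg fy) _; lia.
by rewrite mulr1 addr0 => /esym/eqP; rewrite (negPf c0).
Qed.

Lemma top_pow_v_f a M : (0 < M)%N -> ~ top_pow (e - a *: h - a ^+ 2 *: f) M f.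
Proof.
move=> M0 [c [y [c0 fy fE]]].
have [M1|M1] := leqP M 1.
  (* e - a h - a^2 f vanishes on the line X = - a. *)
  have [F [FC Fg Ff Fv]] := eval_ex (- a).
  have := congr1 (fun x => size (F x)) fE; rewrite rmorphD.
  rewrite -mulr_algl rmorphM rmorphXn Fv addNr mul0r expr0n oppr0 scale0r subr0.
  have -> : M = 1%N by lia.
  rewrite expr0n /= mulr0 add0r Ff size_polyX.
  move=> sy; have := size_fil FC Fg fy; rewrite -sy; lia.
(* At X = 1 - a the element e - ah - a^2 f becomes -(f + q), whose M-th power has nonzero
   coefficient at f^M, against M > 1. *)
have [F [FC Fg Ff Fv]] := eval_ex (1 - a).
have FZ k x : F (k *: x) = k *: F x by rewrite -mulr_algl rmorphM FC mul_polyC.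
have := congr1 (fun x => (F x)`_M) fE; rewrite rmorphD FZ rmorphXn Fv Ff.
have -> : (- ((1 - a + a) * q)%:P - (1 - a + a) ^+ 2 *: 'X) ^+ M =
    ((-1) ^+ M)%:P * ('X + q%:P) ^+ M.
  rewrite subrK mul1r expr1n scale1r polyC_exp polyCN polyC1 -exprMn.
  by rewrite mulN1r opprD addrC.
rewrite coefX coefD coefZ (gtn_eqF M1) [X in _ + X]nth_default; last first.
  by apply: leq_trans (size_fil FC Fg fy) _; lia.
rewrite addr0 coefCM coef_XaddC_exp subnn binn expr0 mulr1n mulr1.
by move/esym/eqP; rewrite mulf_eq0 (negPf c0) signr_eq0.
Qed.

(** Induction from the right end, whose letter acts first: the two step lemmas alternate. M = 1 is
    possible after a triangular letter only if it is the sole letter. *)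
Lemma reduced_word_top (w : seq (bool * Aut_P_lambda lam)) l :
  reduced_word A T (l :: w) ->
  if l.1 then exists2 M, (0 < M)%N /\ (0 < size w -> 1 < M)%N &
       top_pow f M (word_val (l :: w) f)
  else exists2 M, (0 < M)%N &
       exists a, top_pow (e - a *: h - a ^+ 2 *: f) M (word_val (l :: w) f).
Proof.
have f1 : top_pow f 1 f.
  by exists 1, 0; rewrite oner_eq0 scale1r expr1 addr0; split=> //;
    exact: fil_0.
elim: w l => [|k w IH] [b s] [red alt].
  have [fs n0] := red _ (mem_head _ _).
  rewrite word_val_cons /word_val big_nil mulg1 /=;
    case: b fs {red alt} n0 => /= fs n0.
    exists 1%N => //; have [al al0 sf] := triangular_line fs.
    by exists al, 0; rewrite expr1 addr0; split=> //; exact: fil_0.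
  exists 1%N => //; apply: linear_step => // sT; exact: n0.
have [fs n0] := red _ (mem_head _ _).
have {}IH : _ := IH k.
move: alt; rewrite /= => /andP[/= bk alt].
have redk : reduced_word A T (k :: w).
  by split=> // j jw; apply: red; rewrite inE jw orbT.
rewrite [word_val (_ :: k :: _)]word_val_cons paut_mulE /=;
  have {IH} := IH redk.
case: b fs n0 bk {red} => /= fs n0; case: (k.1) => // _.
  move=> [M M0 [a top]].
  have nA : ~ A s by move=> sA; apply: n0.
  have [M' M'1 top'] := triangular_step M0 fs nA top.
  exists M'; last exact: top'.
  by split=> [|_]; [apply: leq_trans M'1|exact: M'1].
move=> [M [M0 _] top]; exists M => //; apply: linear_step => // sT; exact: n0.
Qed.

Lemma reduced_word_neq1 (w : seq (bool * Aut_P_lambda lam)) :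
  reduced_word A T w -> (1 < size w)%N -> word_val w <> 1%g.
Proof.
case: w => // l [//|k w] red _ w1; have := reduced_word_top red.
rewrite w1; case: ifP => _.
  by case=> M [M0 M1] /top_pow_f; rewrite leqNgt M1.
by case=> M M0 [a top]; exact: (top_pow_v_f M0 top).
Qed.

End Filtration.

Theorem theorem2 (K : closedFieldType) (charK0 : [pchar K]%R =i pred0)
  (lam : K) :
  is_amalgamated_product
    (linear_auts lam) (triangular_auts lam)
    (linear_auts lam `&` triangular_auts lam)%classic.
Proof.
(* Algebraic closure provides the square root of lam on which the coordinates X, f depend. *)
have [q qE] : exists q : K, q ^+ 2 = lam.
  have [q qE] := @solve_monicpoly K 2 (fun i => if i == 0%N then lam else 0)
    isT.
  by exists q; rewrite qE !big_ord_recl big_ord0 /= mulr1 mul0r !addr0.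
have [emb embP] := embedding_ex qE.
have subA := linear_subgroup charK0 embP; have subT := triangular_subgroup lam.
split=> //; first exact: (generation charK0 embP).
apply: amalgam_injective => // w; exact: (reduced_word_neq1 charK0 embP).
Qed.
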